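(* Let $u\in\ell^2(\mathbb{Z})$, with Fourier rearrangement $u^\#$, and let $k\ge 0$ be an integer. Then $$\text{(a)}\qquad \sum_{n\in\mathbb{Z}}|\Delta^k u(n)|^2\ \ge\ \sum_{n\in\mathbb{Z}}|\Delta^k u^\#(n)|^2$$ and $$\text{(b)}\qquad \sum_{n\in\mathbb{Z}}|D\Delta^k u(n)|^2\ \ge\ \sum_{n\in\mathbb{Z}}|D\Delta^k u^\#(n)|^2 .$$ Moreover, equality holds in (a) or (b) if and only if $|F(u)(x)|=F(u)^*(x)$ for a.e. $x\in(-\pi,\pi)$.
   Context: Functions in $\ell^2(\mathbb{Z})$ are complex-valued. For $u:\mathbb{Z}\to\mathbb{C}$, $Du(n):=u(n)-u(n-1)$ and $\Delta u(n):=2u(n)-u(n-1)-u(n+1)$; $\Delta^k$ is the $k$-fold iterate of $\Delta$, with $\Delta^0$ the identity. For $u\in\ell^2(\mathbb{Z})$ the Fourier transform $F(u)\in L^2((-\pi,\pi))$ and its inverse are $$F(u)(x):=(2\pi)^{-1/2}\sum_{n\in\mathbb{Z}}u(n)e^{-inx},\qquad F^{-1}(f)(n)=(2\pi)^{-1/2}\int_{-\pi}^{\pi}f(x)e^{inx}\,dx .$$ For a measurable $f$ on $(-\pi,\pi)$, extended by $0$ to $\mathbb{R}$, $f^*$ denotes the symmetric decreasing rearrangement on the real line: $f^*(x)=\int_0^\infty\chi_{\{|f|>t\}^*}(x)\,dt$, where $\chi_S$ is the characteristic function of $S$ and, for a measurable set $\Omega\subset\mathbb{R}$ of finite measure, $\Omega^*$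 is the open interval centered at $0$ with the same Lebesgue measure as $\Omega$. The Fourier rearrangement of $u$ is $u^\#:=F^{-1}\big((F(u))^*\big)$, and $F(u)^*$ means $(F(u))^*$.
   Formalization: The equality clause for (a) is stated only for k ≥ 1: for k = 0 equality in (a) holds for every u by Parseval, while |F(u)| = F(u)^* a.e. can fail, e.g. when F(u) is the indicator of (0,π). *)

(* Defs.v *)
From HB Require Import structures.
From mathcomp Require Import all_boot all_order all_algebra.
From mathcomp Require Import all_classical all_reals all_analysis.
From mathcomp Require Import complex.

Set Implicit Arguments.
Unset Strict Implicit.
Unset Printing Implicit Defensive.

Import Order.TTheory GRing.Theory Num.Theory.
Import numFieldNormedType.Exports.

Local Open Scope classical_set_scope.
Local Open Scope ring_scope.
Local Open Scope complex_scope.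

Section Defs.
Context {R : realType}.

Definition expi (t : R) : R[i] := cos t +i* sin t.

Definition Dop (u : int -> R[i]) : int -> R[i] := fun n => u n - u (n - 1).

Definition Lap (u : int -> R[i]) : int -> R[i] :=
  fun n => 2 * u n - u (n - 1) - u (n + 1).

(* Possibly infinite sum, with values in [0, +oo]. *)
Definition sqsum (u : int -> R[i]) : \bar R :=
  \esum_(n in [set: int]) (Normc.normc (u n) ^+ 2)%:E.

Definition l2Z (u : int -> R[i]) : Prop := (sqsum u < +oo)%E.

Definition freq_itv : set R := `]- pi, pi[%classic.

Definition cmeasurable (D : set R) (f : R -> R[i]) : Prop :=
  measurable_fun D (fun x => complex.Re (f x)) /\
  measurable_fun D (fun x => complex.Im (f x)).

Definition cintegral (D : set R) (f : R -> R[i]) : R[i] :=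
  (\int[lebesgue_measure]_(x in D) complex.Re (f x)) +i*
  (\int[lebesgue_measure]_(x in D) complex.Im (f x)).

(* Sum over - N <= n <= N. *)
Definition fourier_psum (u : int -> R[i]) (N : nat) (x : R) : R[i] :=
  ((Num.sqrt (2 * pi))^-1)%:C *
  \sum_(j < N.*2.+1)
    u (j%:Z - N%:Z) * expi (- ((j%:Z - N%:Z)%:~R * x)).

Definition is_fourier (u : int -> R[i]) (f : R -> R[i]) : Prop :=
  [/\ cmeasurable freq_itv f,
      (\int[lebesgue_measure]_(x in freq_itv) (Normc.normc (f x) ^+ 2)%:E < +oo)%E &
      (fun N => \int[lebesgue_measure]_(x in freq_itv)
                  (Normc.normc (fourier_psum u N x - f x) ^+ 2)%:E)%E @ \oo --> 0%E].

(* A representative of the L^2 class F(u); the default value 0 is used only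
   when the series does not converge in L^2, i.e. when u is not in l^2(Z). *)
Definition fourier (u : int -> R[i]) : R -> R[i] :=
  xget (fun _ => 0) [set f | is_fourier u f].

Definition inv_fourier (f : R -> R[i]) (n : int) : R[i] :=
  ((Num.sqrt (2 * pi))^-1)%:C *
  cintegral freq_itv (fun x => f x * expi (n%:~R * x)).

(* [fine] is harmless for sets of finite measure. *)
Definition set_rearr (A : set R) : set R :=
  let m := fine (lebesgue_measure A) in `](- (m / 2)), (m / 2)[%classic.

(* The set {|f| > t} for f on (-pi, pi) extended by 0 to the real line; for
   t >= 0 it is contained in (-pi, pi). *)
Definition superlevel (f : R -> R[i]) (t : R) : set R :=
  freq_itv `&` [set x | t < Normc.normc (f x)].

(* Extended-real valued, since f^*(0) = +oo when f is essentially unbounded. *)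
Definition rearr (f : R -> R[i]) (x : R) : \bar R :=
  (\int[lebesgue_measure]_(t in `[0%R, +oo[) (\1_(set_rearr (superlevel f t)) x)%:E)%E.

Definition fourier_rearr (u : int -> R[i]) : int -> R[i] :=
  inv_fourier (fun x => (fine (rearr (fourier u) x))%:C).

End Defs.

(* Main.v *)
Require Import Defs.
From HB Require Import structures.
From mathcomp Require Import all_boot all_order all_algebra.
From mathcomp Require Import all_classical all_reals all_analysis.
From mathcomp Require Import measurable_realfun.
From mathcomp Require Import complex.
From mathcomp Require Import ring lra zify.

Set Implicit Arguments.
Unset Strict Implicit.
Unset Printing Implicit Defensive.

Import Order.TTheory GRing.Theory Num.Theory.
Import numFieldNormedType.Exports.

Local Open Scope classical_set_scope.
Local Open Scope ring_scope.

(** The Fourier transform turns the Laplacian into multiplication by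
    [w x = 2 - 2 cos x = |1 - e^{-ix}|^2] and [D] into multiplication by
    [1 - e^{-ix}].  With [F] the transform of [u] and [g] its rearrangement, the
    Parseval identity makes the four sums the integrals of [w^m |F|^2] and
    [w^m g^2] over (-pi, pi), where [m = 2k] for (a) and [m = 2k + 1] for (b)
    ([sqsum_iterLap], [sqsum_Dop_iterLap]).  What remains is a rearrangement
    inequality against the weight [w^m], which is even and nondecreasing in
    [|x|], strictly increasing as soon as [m > 0].

    The inequality comes from the layer-cake formula: both integrals are
    integrals over [s >= 0] of the integrals of [w^m] over the sets [|F|^2 > s]
    and [g^2 > s].  These have the same measure, and the second is, up to the
    origin, a centred interval, where [w^m] is smallest; so it has the smaller
    integral ([bathtub_le]).  If the total integrals agree and [m > 0], then for
    almost every [s] the two sets agree up to a null set ([bathtub_eq]), and a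
    dense choice of such levels [s] gives [|F| = g] almost everywhere
    ([comparison_eq]).

    Three facts of Fourier analysis are needed.  The transform of a square
    summable sequence exists ([riesz_fischer]): a subsequence of the partial
    sums with geometrically small increments converges almost everywhere, and
    Fatou's lemma bounds the distance to its limit.  A sequence whose partial
    sums converge to [f] in L^2 has square sum equal to the integral of [|f|^2]
    ([is_fourier_psumsq]), and shifting the sequence multiplies [f] by a
    unimodular exponential ([is_fourier_mul]).

    Finally, the partial sums of [u^#] must converge to [g], which is the
    completeness of the exponentials.  It is only needed for [g], which is
    nonnegative and lower semicontinuous, its superlevel sets being open.  For
    such a function the Fejer means, which are nonnegative, have lower limit at
    least [g] at every point; Fatou's lemma applied to [g] times its Fejer means
    gives the integral of [g^2] as a lower bound for the sum of the squared
    coefficients, and Bessel's identity turns this into L^2 convergence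
    ([is_fourier_inv_lsc]). *)

(** * Complex scalars and symmetric partial sums *)

Section ComplexAlgebra.
Context {R : realType}.
Implicit Types (z w : R[i]) (u : int -> R[i]) (x : R).
Local Open Scope complex_scope.

(** The real inner product of the plane.  Only moduli and real parts of scalar
    products occur below, so working with it keeps every integral real-valued. *)
Definition rdot z w : R :=
  complex.Re z * complex.Re w + complex.Im z * complex.Im w.

Lemma normc_sqE z : Normc.normc z ^+ 2 = rdot z z.
Proof.
by case: z => a b; rewrite /rdot /= sqr_sqrtr ?addr_ge0 ?sqr_ge0// !expr2.
Qed.

Lemma normc_ge0 z : 0 <= Normc.normc z.
Proof. by case: z => a b; exact: sqrtr_ge0. Qed.

Lemma rdotC z w : rdot z w = rdot w z.
Proof. by rewrite /rdot mulrC [X in _ + X]mulrC. Qed.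

Lemma rdotDl z1 z2 w : rdot (z1 + z2) w = rdot z1 w + rdot z2 w.
Proof. by case: z1 z2 w => [a b] [c d] [e f]; rewrite /rdot /=; ring. Qed.

Lemma rdot_ge0 z : 0 <= rdot z z.
Proof. by rewrite -normc_sqE sqr_ge0. Qed.

Lemma rdotM z w : rdot (z * w) (z * w) = rdot z z * rdot w w.
Proof. by case: z w => [a b] [c d]; rewrite /rdot /=; ring. Qed.

Lemma rdot_expi x : rdot (expi x) (expi x) = 1.
Proof. by rewrite /rdot /= -!expr2 cos2Dsin2. Qed.

(** Young's inequality; the free parameter lets limits pass through norms
    without square roots. *)
Lemma rdotD_le (e : R) z w : 0 < e ->
  rdot (z + w) (z + w) <= (1 + e) * rdot z z + (1 + e^-1) * rdot w w.
Proof.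
move=> e0; case: z w => [a b] [c d]; rewrite /rdot /=.
have key (s t : R) : (s + t) * (s + t) <= (1 + e) * (s * s) + (1 + e^-1) * (t * t).
  rewrite -subr_ge0.
  have -> : (1 + e) * (s * s) + (1 + e^-1) * (t * t) - (s + t) * (s + t) =
     e^-1 * (e * s - t) ^+ 2 by field; rewrite gt_eqF.
  by rewrite mulr_ge0 ?sqr_ge0// invr_ge0 ltW.
by move: (key a c) (key b d); lra.
Qed.

Lemma expiD x y : expi (x + y) = expi x * expi y.
Proof.
rewrite /expi cosD sinD; apply/eqP; rewrite eq_complex /=.
by apply/andP; split; apply/eqP; ring.
Qed.

Lemma expi0 : expi (0 : R) = 1.
Proof. by rewrite /expi cos0 sin0. Qed.

Definition symsum (V : nmodType) (F : int -> V) (N : nat) : V :=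
  \sum_(j < N.*2.+1) F (j%:Z - N%:Z).

Lemma symsum0 (V : nmodType) (F : int -> V) : symsum F 0 = F 0.
Proof. by rewrite /symsum big_ord_recl big_ord0 addr0. Qed.

Lemma symsumS (V : nmodType) (F : int -> V) N :
  symsum F N.+1 = symsum F N + (F N.+1%:Z + F (- N.+1%:Z)).
Proof.
rewrite /symsum doubleS big_ord_recl big_ord_recr /= addrCA.
congr (_ + _); first by apply: eq_bigr => j _; congr F; rewrite /bump /=; lia.
by rewrite addrC; congr (F _ + F _); rewrite /bump /=; lia.
Qed.

Lemma eq_symsum (V : nmodType) (F G : int -> V) N :
  (forall n : int, (`|n| <= N)%N -> F n = G n) -> symsum F N = symsum G N.
Proof.
move=> FG; apply: eq_bigr => j _; apply: FG.
have := ltn_ord j; lia.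
Qed.

Lemma symsum_ge0 (F : int -> R) N : (forall n, 0 <= F n) -> 0 <= symsum F N.
Proof. by move=> F0; apply: sumr_ge0. Qed.

(** A shift moves the window of summation by one, so that it changes a
    symmetric sum by two boundary terms only. *)
Lemma symsum_shift (V : zmodType) (F : int -> V) N :
  symsum (fun n => F (n - 1)) N = symsum F N + (F (- N.+1%:Z) - F N%:Z).
Proof.
elim: N => [|N ih]; first by rewrite !symsum0 addrCA subrr addr0; congr F.
rewrite !symsumS ih -!addrA; congr (_ + _).
have -> : N.+1%:Z - 1 = N%:Z by lia.
have -> : - N.+1%:Z - 1 = - N.+2%:Z by lia.
by rewrite addKr [RHS]addrCA [X in _ = _ + X]addrCA subrr addr0.
Qed.

Lemma symsum_delta (V : zmodType) (a : V) (n : int) N : (`|n| <= N)%N ->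
  symsum (fun m => if m == n then a else 0) N = a.
Proof.
move=> nN; rewrite /symsum.
have h : (`|(n + N%:Z)%R| < N.*2.+1)%N by lia.
rewrite (bigD1 (Ordinal h)) //= ifT; last by apply/eqP; lia.
rewrite big1 ?addr0// => j /eqP jn; rewrite ifN//; apply/eqP => e.
by apply: jn; apply: val_inj => /=; lia.
Qed.

Lemma rdot_suml I (s : seq I) (F : I -> R[i]) w :
  rdot (\sum_(i <- s) F i) w = \sum_(i <- s) rdot (F i) w.
Proof.
elim: s => [|i s ih]; first by rewrite !big_nil /rdot /= !mul0r addr0.
by rewrite !big_cons rdotDl ih.
Qed.

Definition fterm u x (n : int) : R[i] :=
  ((Num.sqrt (2 * pi))^-1)%:C * (u n * expi (- (n%:~R * x))).

Lemma fourier_psumE u N : fourier_psum u N = fun x => symsum (fterm u x) N.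
Proof. by apply/funext => x; rewrite /fourier_psum big_distrr. Qed.

End ComplexAlgebra.

(** * Square-integrable functions on the frequency interval *)

Section IntegralLayer.
Context {R : realType}.
Implicit Types (h k : R -> R) (f g : R -> R[i]) (u : int -> R[i]) (x : R).
Local Open Scope complex_scope.
Notation mu := (@lebesgue_measure R).
Notation D := (@freq_itv R).

Definition L1 h := mu.-integrable D (EFin \o h).

Lemma measurable_freq : measurable D.
Proof. exact: measurable_itv. Qed.
Hint Resolve measurable_freq : core.

Lemma measure_freq : mu D = (2 * pi)%:E.
Proof.
rewrite /freq_itv lebesgue_measure_itv/= lte_fin gtrN ?pi_gt0//.
by rewrite -EFinD opprK mulr2n mulrDl mul1r.
Qed.

Lemma eq_mu (A : set R) (F G : R -> \bar R) : (forall x, A x -> F x = G x) ->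
  (\int[mu]_(x in A) F x = \int[mu]_(x in A) G x)%E.
Proof. by move=> FG; apply: eq_integral => x; rewrite inE => /FG. Qed.

Lemma L1_le h k : measurable_fun D h ->
  (forall x, D x -> `|h x| <= k x) -> L1 k -> L1 h.
Proof.
move=> mh hk ik; apply: (le_integrable _ _ _ ik) => //; first exact/measurable_EFinP.
move=> x Dx /=; rewrite lee_fin; apply: (le_trans (hk x Dx)).
exact: ler_norm.
Qed.

Lemma L1_measurable h : L1 h -> measurable_fun D h.
Proof. by move=> /(measurable_int mu) /measurable_EFinP. Qed.

Lemma L1_cst (c : R) : L1 (fun=> c).
Proof.
apply: measurable_bounded_integrable => //.
  by apply: le_lt_trans (ltry (2 * pi)); rewrite -measure_freq.
by exists `|c|; split; [exact: num_real|move=> x cx y _ /=; exact: ltW].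
Qed.

Lemma L1_D h k : L1 h -> L1 k -> L1 (fun x => h x + k x).
Proof. by move=> ih ik; apply: (integrableD _ ih ik). Qed.

Lemma L1_Z (c : R) h : L1 h -> L1 (fun x => c * h x).
Proof. by move=> ih; apply: (integrableZl _ c ih). Qed.

Lemma L1_ext h k : (forall x, D x -> h x = k x) -> L1 h -> L1 k.
Proof.
move=> hk; apply: eq_integrable => // x; rewrite inE => Dx /=.
by rewrite hk.
Qed.

Lemma L1_B h k : L1 h -> L1 k -> L1 (fun x => h x - k x).
Proof.
move=> ih ik; apply: (@L1_ext (fun x => h x + (-1) * k x)).
  by move=> x _; rewrite mulN1r.
by apply: L1_D => //; exact: L1_Z.
Qed.

Lemma L1_mulb h k (C : R) : L1 h -> measurable_fun D k ->
  (forall x, D x -> `|k x| <= C) -> L1 (fun x => k x * h x).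
Proof.
move=> ih mk kC; apply: (@L1_le _ (fun x => C * `|h x|)).
- by apply: measurable_funM => //; exact: L1_measurable.
- by move=> x Dx; rewrite normrM ler_wpM2r ?kC.
- by apply: L1_Z; exact: integrable_norm.
Qed.

Lemma L1_bounded k (C : R) : measurable_fun D k ->
  (forall x, D x -> `|k x| <= C) -> L1 k.
Proof.
move=> mk kC; apply: (@L1_ext (fun x => k x * 1)) => [x _|]; first by rewrite mulr1.
by apply: (L1_mulb (L1_cst 1)) => //; exact: kC.
Qed.

Lemma L1_sum n (F : 'I_n -> R -> R) : (forall i, L1 (F i)) ->
  L1 (fun x => \sum_(i < n) F i x).
Proof.
elim: n F => [|n ih] F iF.
  by apply: (@L1_ext (fun=> 0)); [move=> x _; rewrite big_ord0|exact: L1_cst].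
apply: (@L1_ext (fun x => F ord0 x + \sum_(i < n) F (lift ord0 i) x)).
  by move=> x _; rewrite big_ord_recl.
by apply: L1_D => //; exact: ih.
Qed.

Notation I h := (\int[mu]_(x in D) h x).

Lemma eq_I h k : (forall x, D x -> h x = k x) -> I h = I k.
Proof. by move=> hk; apply: eq_Rintegral => x; rewrite inE => /hk. Qed.

Lemma I_D h k : L1 h -> L1 k -> I (fun x => h x + k x) = I h + I k.
Proof. by move=> ih ik; apply: RintegralD. Qed.

Lemma I_B h k : L1 h -> L1 k -> I (fun x => h x - k x) = I h - I k.
Proof. by move=> ih ik; apply: RintegralB. Qed.

Lemma I_Z (c : R) h : L1 h -> I (fun x => c * h x) = c * I h.
Proof. by move=> ih; apply: RintegralZl. Qed.

Lemma le_I h k : L1 h -> L1 k -> (forall x, D x -> h x <= k x) -> I h <= I k.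
Proof. by move=> ih ik hk; apply: le_Rintegral. Qed.

Lemma I_sum n (F : 'I_n -> R -> R) : (forall i, L1 (F i)) ->
  I (fun x => \sum_(i < n) F i x) = \sum_(i < n) I (F i).
Proof.
elim: n F => [|n ih] F iF.
  rewrite big_ord0 (@eq_Rintegral _ _ _ _ _ (fun=> 0)).
    by rewrite Rintegral_cst// mul0r.
  by move=> x _; rewrite big_ord0.
rewrite big_ord_recl -ih// -RintegralD//; last 2 first.
- exact: iF.
- exact: L1_sum.
by apply: eq_Rintegral => x _; rewrite big_ord_recl.
Qed.

Lemma I_cst (r : R) : I (fun=> r) = r * (2 * pi).
Proof. by rewrite Rintegral_cst//; have /= -> := measure_freq. Qed.

(** Square integrability is asked of [rdot (f x) (f x)], the squared modulus,
    because it is a polynomial in the real and imaginary parts. *)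
Definition L2 f := cmeasurable D f /\ L1 (fun x => rdot (f x) (f x)).
Definition rip f g : R := I (fun x => rdot (f x) (g x)).

Lemma cmeasD f g : cmeasurable D f -> cmeasurable D g ->
  cmeasurable D (fun x => f x + g x).
Proof.
move=> [rf jf] [rg jg]; split.
  rewrite (_ : (fun x => _) = (fun x => complex.Re (f x) + complex.Re (g x))).
    exact: measurable_funD.
  by apply/funext => x; case: (f x) (g x) => ? ? [].
rewrite (_ : (fun x => _) = (fun x => complex.Im (f x) + complex.Im (g x))).
  exact: measurable_funD.
by apply/funext => x; case: (f x) (g x) => ? ? [].
Qed.

Lemma cmeasM f g : cmeasurable D f -> cmeasurable D g ->
  cmeasurable D (fun x => f x * g x).
Proof.
move=> [rf jf] [rg jg]; split.
  rewrite (_ : (fun x => _) = (fun x =>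
    complex.Re (f x) * complex.Re (g x) - complex.Im (f x) * complex.Im (g x))).
    by apply: measurable_funB; exact: measurable_funM.
  by apply/funext => x; case: (f x) (g x) => ? ? [].
rewrite (_ : (fun x => _) = (fun x =>
    complex.Re (f x) * complex.Im (g x) + complex.Im (f x) * complex.Re (g x))).
  by apply: measurable_funD; exact: measurable_funM.
by apply/funext => x; case: (f x) (g x) => ? ? [].
Qed.

Lemma cmeas_cst (c : R[i]) : cmeasurable D (fun=> c).
Proof. by split; exact: measurable_cst. Qed.

Lemma cmeas_real h : measurable_fun D h -> cmeasurable D (fun x => (h x)%:C).
Proof. by move=> mh; split=> //=; exact: measurable_cst. Qed.

Lemma continuous_mulc (a : R) : continuous (fun x : R => a * x).
Proof. by move=> x; apply: cvgM; [exact: cvg_cst|exact: cvg_id]. Qed.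

Lemma measurable_cosM (a : R) : measurable_fun D (fun x => cos (a * x)).
Proof.
apply: measurable_funTS; apply: continuous_measurable_fun => x.
by apply: continuous_comp; [exact: continuous_mulc|exact: continuous_cos].
Qed.

Lemma measurable_sinM (a : R) : measurable_fun D (fun x => sin (a * x)).
Proof.
apply: measurable_funTS; apply: continuous_measurable_fun => x.
by apply: continuous_comp; [exact: continuous_mulc|exact: continuous_sin].
Qed.

Lemma cmeas_expi (a : R) : cmeasurable D (fun x => expi (a * x)).
Proof. by split; [exact: measurable_cosM|exact: measurable_sinM]. Qed.

Lemma measurable_rdot f g : cmeasurable D f -> cmeasurable D g ->
  measurable_fun D (fun x => rdot (f x) (g x)).
Proof.
by move=> [rf jf] [rg jg]; apply: measurable_funD; exact: measurable_funM.
Qed.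

(** On the pointwise level [|z . w| <= |z|^2 + |w|^2]. *)
Lemma L2_rdot f g : L2 f -> L2 g -> L1 (fun x => rdot (f x) (g x)).
Proof.
move=> [mf jf] [mg jg].
apply: (@L1_le _ (fun x => rdot (f x) (f x) + rdot (g x) (g x))).
- exact: measurable_rdot.
- move=> x _; case: (f x) (g x) => [a b] [c d]; rewrite /rdot /= ler_norml.
  apply/andP; split; rewrite -subr_ge0.
  + by have := sqr_ge0 (a + c); have := sqr_ge0 (b + d); have := sqr_ge0 a;
    have := sqr_ge0 b; have := sqr_ge0 c; have := sqr_ge0 d; nra.
  + by have := sqr_ge0 (a - c); have := sqr_ge0 (b - d); have := sqr_ge0 a;
    have := sqr_ge0 b; have := sqr_ge0 c; have := sqr_ge0 d; nra.
- exact: L1_D.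
Qed.

Lemma L2_D f g : L2 f -> L2 g -> L2 (fun x => f x + g x).
Proof.
move=> [mf jf] [mg jg]; split; first exact: cmeasD.
apply: (@L1_le _ (fun x => (1 + 1) * rdot (f x) (f x) + (1 + 1^-1) * rdot (g x) (g x))).
- by apply: measurable_rdot; exact: cmeasD.
- by move=> x _; rewrite ger0_norm ?rdot_ge0// rdotD_le.
- by apply: L1_D; exact: L1_Z.
Qed.

Lemma L2_mulb f g (C : R) : L2 f -> cmeasurable D g ->
  (forall x, D x -> rdot (g x) (g x) <= C) -> L2 (fun x => g x * f x).
Proof.
move=> [mf jf] mg gC; split; first exact: cmeasM.
apply: (@L1_ext (fun x => rdot (g x) (g x) * rdot (f x) (f x))).
  by move=> x _; rewrite rdotM.
apply: (L1_mulb jf (C := C)); first exact: measurable_rdot.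
by move=> x Dx; rewrite ger0_norm ?gC ?rdot_ge0.
Qed.

Lemma L2_bounded g (C : R) : cmeasurable D g ->
  (forall x, D x -> rdot (g x) (g x) <= C) -> L2 g.
Proof.
move=> mg gC; split=> //; apply: (L1_bounded (C := C)).
  exact: measurable_rdot.
by move=> x Dx; rewrite ger0_norm ?gC ?rdot_ge0.
Qed.

Lemma L2_N f : L2 f -> L2 (fun x => - f x).
Proof.
move=> Lf; rewrite (_ : (fun x => _) = (fun x => (-1) * f x)); last first.
  by apply/funext => x; rewrite mulN1r.
by apply: (L2_mulb (C := rdot (-1) (-1)) Lf) => //; exact: cmeas_cst.
Qed.

Lemma L2_B f g : L2 f -> L2 g -> L2 (fun x => f x - g x).
Proof. by move=> Lf Lg; apply: L2_D => //; exact: L2_N. Qed.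

Lemma rip_ge0 f : 0 <= rip f f.
Proof. by apply: Rintegral_ge0 => x _; exact: rdot_ge0. Qed.

Lemma ripC f g : rip f g = rip g f.
Proof. by apply: eq_Rintegral => x _; rewrite rdotC. Qed.

Lemma ripDl f1 f2 g : L2 f1 -> L2 f2 -> L2 g ->
  rip (fun x => f1 x + f2 x) g = rip f1 g + rip f2 g.
Proof.
move=> L1f L2f Lg; rewrite -RintegralD//; try exact: L2_rdot.
by apply: eq_Rintegral => x _; rewrite rdotDl.
Qed.

Lemma ripB f g : L2 f -> L2 g ->
  rip (fun x => f x - g x) (fun x => f x - g x) = rip f f - 2 * rip f g + rip g g.
Proof.
move=> Lf Lg.
have jfg := L2_rdot Lf Lg; have jff := L2_rdot Lf Lf; have jgg := L2_rdot Lg Lg.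
rewrite /rip -RintegralZl// -RintegralB//; last exact: L1_Z.
rewrite -RintegralD//; last by apply: L1_B => //; exact: L1_Z.
apply: eq_Rintegral => x _.
by case: (f x) (g x) => [a b] [c d]; rewrite /rdot /=; ring.
Qed.

Lemma ripD_le (e : R) f g : 0 < e -> L2 f -> L2 g ->
  rip (fun x => f x + g x) (fun x => f x + g x) <=
  (1 + e) * rip f f + (1 + e^-1) * rip g g.
Proof.
move=> e0 Lf Lg; have jff := L2_rdot Lf Lf; have jgg := L2_rdot Lg Lg.
rewrite /rip -!RintegralZl// -RintegralD//; try exact: L1_Z.
apply: le_Rintegral => //.
- by case: (L2_D Lf Lg).
- by apply: L1_D; exact: L1_Z.
- by move=> x _; exact: rdotD_le.
Qed.

Lemma integral_rip f : L2 f ->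
  (\int[mu]_(x in D) (Normc.normc (f x) ^+ 2)%:E = (rip f f)%:E)%E.
Proof.
move=> [mf jf]; rewrite /rip /Rintegral fineK; last exact: integrable_fin_num.
by apply: eq_integral => x _; rewrite normc_sqE.
Qed.

Lemma L2P f : L2 f <-> cmeasurable D f /\
  (\int[mu]_(x in D) (Normc.normc (f x) ^+ 2)%:E < +oo)%E.
Proof.
split=> [Lf|[mf foo]].
  by split; [case: Lf|rewrite integral_rip// ltry].
split=> //; apply/integrableP; split.
  by apply/measurable_EFinP; exact: measurable_rdot.
rewrite (le_lt_trans _ foo)// le_eqVlt; apply/orP; left; apply/eqP.
apply: eq_integral => x _ /=.
by rewrite ger0_norm ?rdot_ge0// normc_sqE.
Qed.

(** The interval has finite measure, so L^2 is contained in L^1: pointwise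
    [|t| <= 1 + t^2]. *)
Lemma L2_ReIm f : L2 f ->
  L1 (fun x => complex.Re (f x)) /\ L1 (fun x => complex.Im (f x)).
Proof.
move=> Lf; have [[mr mi] jf] := Lf.
have j : L1 (fun x => 1 + rdot (f x) (f x)) by apply: L1_D => //; exact: L1_cst.
split; apply: (L1_le _ _ j) => // x _; case: (f x) => [a b]; rewrite /rdot /=.
  rewrite ler_norml; apply/andP; split; rewrite -subr_ge0.
    by have := sqr_ge0 (a + 1); have := sqr_ge0 b; have := sqr_ge0 a; nra.
  by have := sqr_ge0 (a - 1); have := sqr_ge0 b; have := sqr_ge0 a; nra.
rewrite ler_norml; apply/andP; split; rewrite -subr_ge0.
  by have := sqr_ge0 (b + 1); have := sqr_ge0 b; have := sqr_ge0 a; nra.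
by have := sqr_ge0 (b - 1); have := sqr_ge0 b; have := sqr_ge0 a; nra.
Qed.

End IntegralLayer.
#[global] Hint Extern 0 (@measurable _ _ freq_itv) =>
  solve [exact: measurable_freq] : core.

(** * Orthogonality of the exponentials *)

Section Orthogonality.
Context {R : realType}.
Implicit Types (h k : R -> R) (f g : R -> R[i]) (u w : int -> R[i]) (x : R).
Local Open Scope complex_scope.
Notation mu := (@lebesgue_measure R).
Notation D := (@freq_itv R).
Notation I h := (\int[mu]_(x in D) h x).

Lemma sin_intpi (n : int) : sin (n%:~R * pi) = 0 :> R.
Proof.
have nat_case (m : nat) : sin (m%:R * pi) = 0 :> R.
  elim: m => [|m ih]; first by rewrite mul0r sin0.
  by rewrite -natr1 mulrDl mul1r sinDpi ih oppr0.
case: n => m; first exact: nat_case.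
by rewrite NegzE mulrNz mulNr sinN nat_case oppr0.
Qed.

Lemma integral_freq_derive (F f : R -> R) :
  (forall x, is_derive x 1 F (f x)) -> continuous f -> I f = F pi - F (- pi).
Proof.
move=> dF cf.
have pi0 := pi_gt0 R.
have cF : continuous F.
  move=> x; apply: differentiable_continuous.
  by apply/derivable1_diffP; have [] := dF x.
rewrite /Rintegral -(@integral_itv_bndoo _ _ _ _ true false); last first.
  apply/measurable_EFinP; apply: measurable_funTS.
  exact: continuous_measurable_fun.
rewrite (@continuous_FTC2 _ f F).
- by [].
- by rewrite gtrN.
- exact: continuous_subspaceT.
- split.
  + by move=> x _; have [] := dF x.
  + by apply: cvg_at_right_filter; exact: cF.
  + by apply: cvg_at_left_filter; exact: cF.
- by move=> x _; rewrite derive1E; have [] := dF x.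
Qed.

Lemma I_cosM (n : int) : I (fun x => cos (n%:~R * x)) = if n == 0 then 2 * pi else 0.
Proof.
case: eqP => [->|/eqP n0].
  rewrite (@eq_Rintegral _ _ _ _ _ (fun=> 1)); last first.
    by move=> x _; rewrite mul0r cos0.
  by rewrite I_cst mul1r.
have nR : n%:~R != 0 :> R by rewrite intr_eq0.
have dF x : is_derive x (1 : R) (fun x => n%:~R^-1 * sin (n%:~R * x))
    (cos (n%:~R * x)).
  apply: is_derive_eq.
  by rewrite /GRing.scale /= mulr1 mulrCA mulVf// mulr1.
rewrite (integral_freq_derive dF).
  by rewrite mulrN sinN !sin_intpi oppr0 mulr0 subrr.
move=> x; apply: continuous_comp; first exact: continuous_mulc.
exact: continuous_cos.
Qed.

Lemma I_sinM (n : int) : I (fun x => sin (n%:~R * x)) = 0.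
Proof.
case: (eqVneq n 0) => [->|n0].
  rewrite (@eq_Rintegral _ _ _ _ _ (fun=> 0)); last first.
    by move=> x _; rewrite mul0r sin0.
  by rewrite I_cst mul0r.
have nR : n%:~R != 0 :> R by rewrite intr_eq0.
have dF x : is_derive x (1 : R) (fun x => - (n%:~R^-1 * cos (n%:~R * x)))
    (sin (n%:~R * x)).
  apply: is_derive_eq.
  by rewrite /GRing.scale /= mulr1 mulNr mulrN opprK mulrCA mulVf// mulr1.
rewrite (integral_freq_derive dF); first by rewrite mulrN cosN subrr.
move=> x; apply: continuous_comp; first exact: continuous_mulc.
exact: continuous_sin.
Qed.

Definition rsqrt2pi : R := (Num.sqrt (2 * pi))^-1.

Lemma nrm_sq : rsqrt2pi * rsqrt2pi * (2 * pi) = 1.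
Proof.
have p0 : 0 < 2 * pi :> R by rewrite mulr_gt0 ?pi_gt0.
by rewrite /rsqrt2pi -invfM -expr2 sqr_sqrtr ?ltW// mulVf ?gt_eqF.
Qed.

Lemma rdot_scale (a : R) (z : R[i]) : rdot (a%:C * z) (a%:C * z) = a * a * rdot z z.
Proof. by rewrite rdotM /rdot /= mulr0 addr0. Qed.

Lemma rdot_fterm w x n : rdot (fterm w x n) (fterm w x n) = rsqrt2pi * rsqrt2pi * rdot (w n) (w n).
Proof. by rewrite /fterm rdot_scale rdotM -mulNr rdot_expi mulr1. Qed.

Lemma cmeas_fterm w n : cmeasurable D (fun x => fterm w x n).
Proof.
apply: cmeasM; first exact: cmeas_cst.
apply: cmeasM; first exact: cmeas_cst.
under eq_fun do rewrite -mulNr.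
exact: cmeas_expi.
Qed.

Lemma L2_fterm w n : L2 (fun x => fterm w x n).
Proof.
apply: (L2_bounded (C := rsqrt2pi * rsqrt2pi * rdot (w n) (w n))).
  exact: cmeas_fterm.
by move=> x _; rewrite rdot_fterm.
Qed.

Lemma L2_symsum (F : R -> int -> R[i]) N :
  (forall n, L2 (F^~ n)) -> L2 (fun x => symsum (F x) N).
Proof.
move=> LF; elim: N => [|N ih].
  by under eq_fun do rewrite symsum0.
by under eq_fun do rewrite symsumS; apply: L2_D => //; apply: L2_D.
Qed.

Lemma L2_fourier_psum w N : L2 (fourier_psum w N).
Proof.
rewrite fourier_psumE.
by apply: L2_symsum => n; exact: L2_fterm.
Qed.

Lemma rip_symsum (F : R -> int -> R[i]) f N : (forall n, L2 (F^~ n)) -> L2 f ->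
  rip (fun x => symsum (F x) N) f = symsum (fun n => rip (F^~ n) f) N.
Proof.
move=> LF Lf; elim: N => [|N ih].
  by rewrite symsum0; apply: eq_Rintegral => x _; rewrite symsum0.
rewrite symsumS -ih -!ripDl//; last 2 first.
- exact: L2_symsum.
- exact: L2_D.
by apply: eq_Rintegral => x _; rewrite symsumS.
Qed.

(** Testing a function against one term of a Fourier series reads off the
    corresponding coefficient; this and [rip_fterms] are the whole
    orthogonality theory needed. *)
Lemma rip_fterm w n f : L2 f ->
  rip (fun x => fterm w x n) f = rdot (w n) (inv_fourier f n).
Proof.
move=> Lf; rewrite /inv_fourier /cintegral -/rsqrt2pi.
have Le : L2 (fun x => f x * expi (n%:~R * x)).
  under eq_fun do rewrite mulrC.
  apply: (L2_mulb (C := 1)) => //; first exact: cmeas_expi.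
  by move=> x _; rewrite rdot_expi.
have [jr ji] := L2_ReIm Le.
have rdotE (a b : R) : rdot (w n) (rsqrt2pi%:C * (a +i* b)) =
    rsqrt2pi * complex.Re (w n) * a + rsqrt2pi * complex.Im (w n) * b.
  by case: (w n) => p q; rewrite /rdot /=; ring.
rewrite rdotE -!RintegralZl// -RintegralD//; try exact: L1_Z.
apply: eq_Rintegral => x _; rewrite /fterm -/rsqrt2pi /expi cosN sinN.
by case: (w n) (f x) => [p q] [r s]; rewrite /rdot /=; ring.
Qed.

Lemma rip_fterms u w m n :
  rip (fun x => fterm u x m) (fun x => fterm w x n) =
  if m == n then rdot (u n) (w n) else 0.
Proof.
have jc : L1 (fun x => cos ((m - n)%:~R * x) : R).
  apply: (L1_bounded (C := 1)); first exact: measurable_cosM.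
  by move=> x _; rewrite ler_norml cos_geN1 cos_le1.
have js : L1 (fun x => sin ((m - n)%:~R * x) : R).
  apply: (L1_bounded (C := 1)); first exact: measurable_sinM.
  by move=> x _; rewrite ler_norml sin_geN1 sin_le1.
pose B : R := complex.Im (u m) * complex.Re (w n) - complex.Re (u m) * complex.Im (w n).
transitivity (I (fun x =>
    rsqrt2pi * rsqrt2pi * rdot (u m) (w n) * cos ((m - n)%:~R * x) +
    rsqrt2pi * rsqrt2pi * B * sin ((m - n)%:~R * x))).
  apply: eq_I => x _; rewrite /fterm -/rsqrt2pi /expi !cosN !sinN intrB mulrBl cosB sinB /B.
  by case: (u m) (w n) => [p q] [r s]; rewrite /rdot /=; ring.
rewrite I_D; try exact: L1_Z.
rewrite !I_Z// I_sinM I_cosM mulr0 addr0 subr_eq0.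
case: eqP => [->|]; last by rewrite mulr0.
by rewrite mulrAC nrm_sq mul1r.
Qed.

Lemma rip_psum w f N : L2 f ->
  rip (fourier_psum w N) f = symsum (fun n => rdot (w n) (inv_fourier f n)) N.
Proof.
move=> Lf; rewrite fourier_psumE rip_symsum//; last by move=> n; exact: L2_fterm.
by apply: eq_symsum => n _; exact: rip_fterm.
Qed.

Definition psumsq w N : R := symsum (fun n => rdot (w n) (w n)) N.

Lemma rip_psums u N M : (N <= M)%N ->
  rip (fourier_psum u N) (fourier_psum u M) = psumsq u N.
Proof.
move=> NM; rewrite !fourier_psumE rip_symsum//; last 2 first.
- by move=> n; exact: L2_fterm.
- by rewrite -fourier_psumE; exact: L2_fourier_psum.
apply: eq_symsum => n nN; rewrite ripC rip_symsum; last 2 first.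
- by move=> k; exact: L2_fterm.
- exact: L2_fterm.
under eq_symsum do rewrite rip_fterms.
by rewrite symsum_delta// (leq_trans nN).
Qed.

Lemma rip_psum_diff u N M : (N <= M)%N ->
  rip (fun x => fourier_psum u N x - fourier_psum u M x)
      (fun x => fourier_psum u N x - fourier_psum u M x) = psumsq u M - psumsq u N.
Proof.
move=> NM; rewrite ripB; try exact: L2_fourier_psum.
by rewrite !rip_psums//; ring.
Qed.

(** The partial sum with the coefficients of [g] is its orthogonal projection,
    so the distance is the defect in Bessel's inequality. *)
Lemma bessel_identity g N : L2 g ->
  rip (fun x => fourier_psum (inv_fourier g) N x - g x)
      (fun x => fourier_psum (inv_fourier g) N x - g x) =
  rip g g - psumsq (inv_fourier g) N.
Proof.
move=> Lg; rewrite ripB//; last exact: L2_fourier_psum.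
by rewrite rip_psums// rip_psum// -/(psumsq _ N); ring.
Qed.

Lemma psumsq_ge0 w N : 0 <= psumsq w N.
Proof. by apply: symsum_ge0 => n; exact: rdot_ge0. Qed.

Lemma psumsq_homo w : {homo psumsq w : N M / (N <= M)%N >-> N <= M}.
Proof.
apply: homo_leq => [//|x y z|N]; first exact: le_trans.
by rewrite /psumsq symsumS lerDl addr_ge0 ?rdot_ge0.
Qed.

End Orthogonality.

(** * Parseval identity *)

Section Parseval.
Context {R : realType}.
Implicit Types (h k : R -> R) (f g : R -> R[i]) (u w : int -> R[i]) (x : R).
Local Open Scope complex_scope.
Notation mu := (@lebesgue_measure R).
Notation D := (@freq_itv R).
Notation I h := (\int[mu]_(x in D) h x).

Definition fourier_err u f N : R :=
  rip (fun x => fourier_psum u N x - f x) (fun x => fourier_psum u N x - f x).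

Lemma fourier_err_ge0 u f N : 0 <= fourier_err u f N. Proof. exact: rip_ge0. Qed.

(** From here on the L^2 convergence is that of a sequence of real numbers. *)
Lemma is_fourierP u f :
  is_fourier u f <-> L2 f /\ (fourier_err u f @ \oo --> (0 : R)).
Proof.
have errE : L2 f -> (fun N => \int[mu]_(x in D)
    (Normc.normc (fourier_psum u N x - f x) ^+ 2)%:E)%E = EFin \o fourier_err u f.
  move=> Lf; apply/funext => N; rewrite (@integral_rip _ (fun x => _ - _))//.
  by apply: L2_B => //; exact: L2_fourier_psum.
split=> [[mf foo]|[Lf dl]].
  have Lf : L2 f by apply/L2P.
  by rewrite errE// => /fine_cvgP[_].
have [mf foo] := (L2P f).1 Lf.
split; [exact: mf|exact: foo|rewrite errE//].
by apply/fine_cvgP; split; [exact: nearW|exact: dl].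
Qed.

Lemma psumsq_normcE u N :
  \sum_(x \in [set` [seq j%:Z - N%:Z | j <- iota 0 N.*2.+1]])
    (Normc.normc (u x) ^+ 2)%:E = (psumsq u N)%:E.
Proof.
rewrite -fsbig_seq; last first.
  rewrite map_inj_uniq ?iota_uniq// => a b; lia.
rewrite big_map /psumsq /symsum -sumEFin -(big_mkord xpredT (fun j : nat =>
  (rdot (u (j%:Z - N%:Z)) (u (j%:Z - N%:Z)))%:E)) /index_iota subn0.
by apply: eq_bigr => j _; rewrite normc_sqE.
Qed.

Lemma mem_sym_range (n : int) N : (`|n| <= N)%N ->
  n \in [seq j%:Z - N%:Z | j <- iota 0 N.*2.+1].
Proof.
move=> nN; apply/mapP; exists `|(n + N%:Z)%R|%N; last by lia.
by rewrite mem_iota; lia.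
Qed.

Lemma psumsq_le_sqsum u N : ((psumsq u N)%:E <= sqsum u)%E.
Proof.
apply: esum_ge; exists [set` [seq j%:Z - N%:Z | j <- iota 0 N.*2.+1]].
  by split=> //; exact: finite_seq.
by rewrite psumsq_normcE.
Qed.

Lemma sqsum_le u (s : R) : (forall N, psumsq u N <= s) -> (sqsum u <= s%:E)%E.
Proof.
move=> us; apply: ge_ereal_sup => _ [A [/finite_seqP[r ->] _] <-].
pose N := \max_(n <- r) `|n|%N.
have rN n : n \in r -> (`|n| <= N)%N by move=> nr; exact: leq_bigmax_seq.
apply: (@le_trans _ _ (psumsq u N)%:E); last by rewrite lee_fin.
rewrite -psumsq_normcE; apply: lee_fsum_nneg_subset.
- exact: finite_seq.
- exact: finite_seq.
- by move=> n; rewrite !inE /= => nr; apply: mem_sym_range; exact: rN.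
- by move=> n _; rewrite lee_fin sqr_ge0.
Qed.

(** A sum of nonnegative terms over the integers may be computed along the
    symmetric windows, since every finite set lies in one of them. *)
Lemma sqsum_cvg u (s : R) : (psumsq u @ \oo --> s) -> sqsum u = s%:E.
Proof.
move=> us; apply/eqP; rewrite eq_le; apply/andP; split.
  apply: sqsum_le => N; rewrite -(cvg_lim _ us)//.
  apply: nondecreasing_cvgn_le; first exact: psumsq_homo.
  by apply/cvg_ex; exists s.
have [s0|] := leP s 0.
  apply: (@le_trans _ _ 0%E); first by rewrite lee_fin.
  by apply: le_trans (psumsq_le_sqsum u 0); rewrite lee_fin psumsq_ge0.
move=> s0; rewrite leNgt; apply/negP => lt_s.
have fs : sqsum u \is a fin_num.
  rewrite ge0_fin_numE; first exact: (lt_trans lt_s (ltry _)).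
  by apply: le_trans (psumsq_le_sqsum u 0); rewrite lee_fin psumsq_ge0.
move: lt_s; rewrite -(fineK fs) lte_fin ltNge => /negP; apply.
rewrite -(cvg_lim _ us)//; apply: limr_le; first by apply/cvg_ex; exists s.
by near=> N; rewrite -lee_fin fineK// psumsq_le_sqsum.
Unshelve. all: by end_near. Qed.

Lemma l2Z_cvg u : l2Z u -> cvgn (psumsq u).
Proof.
move=> hu; apply: nondecreasing_is_cvgn; first exact: psumsq_homo.
have fs : sqsum u \is a fin_num.
  rewrite ge0_fin_numE//.
  by apply: le_trans (psumsq_le_sqsum u 0); rewrite lee_fin psumsq_ge0.
by exists (fine (sqsum u)) => _ [N _ <-]; rewrite -lee_fin fineK// psumsq_le_sqsum.
Qed.

Lemma le_one_add_eps (a b : R) : 0 <= b ->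
  (forall e, 0 < e -> a <= (1 + e) * b) -> a <= b.
Proof.
move=> b0 ab; apply/ler_addgt0Pr => e e0.
have b1 : 0 < b + 1 by rewrite ltr_wpDl.
apply: (le_trans (ab (e / (b + 1)) (divr_gt0 e0 b1))).
rewrite mulrDl mul1r lerD2l mulrAC ler_pdivrMr// ler_wpM2l ?(ltW e0)//.
by rewrite lerDl.
Qed.

(** Parseval.  The squared norms of the partial sums and of [f] are compared in
    both directions up to a factor [1 + e] and a multiple of the error, which
    tends to 0; then [e] is arbitrary. *)
Lemma is_fourier_psumsq u f : is_fourier u f -> psumsq u @ \oo --> rip f f.
Proof.
move=> /is_fourierP[Lf dl].
have LS N := L2_fourier_psum u N.
have up e N : 0 < e -> psumsq u N <= (1 + e) * rip f f + (1 + e^-1) * fourier_err u f N.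
  move=> e0; rewrite -(rip_psums u (leqnn N)).
  have := ripD_le e0 Lf (L2_B (LS N) Lf).
  rewrite (_ : (fun x => f x + _) = fourier_psum u N)//.
  by apply/funext => x; rewrite addrC subrK.
have lo e N : 0 < e -> rip f f <= (1 + e) * psumsq u N + (1 + e^-1) * fourier_err u f N.
  move=> e0; rewrite -(rip_psums u (leqnn N)).
  have := ripD_le e0 (LS N) (L2_N (L2_B (LS N) Lf)).
  rewrite (_ : (fun x => fourier_psum u N x - _) = f); last first.
    by apply/funext => x; rewrite opprB addrC subrK.
  move/le_trans; apply; rewrite lerD2l le_eqVlt; apply/orP; left; apply/eqP.
  by congr (_ * _); apply: eq_I => x _; rewrite /rdot /=; case: (_ - _) => a b /=; ring.
have [B dB] : exists B, forall N, fourier_err u f N <= B.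
  have /cvg_seq_bounded[B [_ /(_ (B + 1))]] : cvgn (fourier_err u f) by apply/cvg_ex; exists 0.
  rewrite ltrDl ltr01 => /(_ isT) H; exists (B + 1) => N.
  by apply: le_trans (H N Logic.I); exact: ler_norm.
have cs : cvgn (psumsq u).
  apply: nondecreasing_is_cvgn; first exact: psumsq_homo.
  exists (2 * rip f f + 2 * B) => _ [N _ <-].
  apply: (le_trans (up 1 N ltr01)).
  have := dB N; rewrite invr1; lra.
have es e (c : R) : (1 + e^-1) * fourier_err u f n @[n --> \oo] --> (0 : R).
  by rewrite -(mulr0 (1 + e^-1)); apply: cvgMr.
suff -> : rip f f = limn (psumsq u) by [].
have F0 := rip_ge0 f.
have s0 : 0 <= limn (psumsq u).
  by apply: limr_ge => //; near=> N; exact: psumsq_ge0.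
apply/eqP; rewrite eq_le; apply/andP; split; apply: le_one_add_eps => // e e0.
  have c1 : (1 + e) * psumsq u n + (1 + e^-1) * fourier_err u f n @[n --> \oo] -->
      (1 + e) * limn (psumsq u).
    by rewrite -[X in _ --> X]addr0; apply: cvgD; [exact: cvgMr|exact: es].
  rewrite -(cvg_lim _ c1)//; apply: limr_ge; first by apply/cvg_ex; eexists; exact: c1.
  by near=> N; exact: lo.
have c1 : (1 + e) * rip f f + (1 + e^-1) * fourier_err u f n @[n --> \oo] -->
      (1 + e) * rip f f.
  by rewrite -[X in _ --> X]addr0; apply: cvgD; [exact: cvg_cst|exact: es].
rewrite -(cvg_lim _ c1)//; apply: ler_lim => //.
  by apply/cvg_ex; eexists; exact: c1.
by near=> N; exact: up.
Unshelve. all: by end_near. Qed.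

End Parseval.

(** * Difference operators as Fourier multipliers *)

Section Operators.
Context {R : realType}.
Implicit Types (h k : R -> R) (f g e : R -> R[i]) (u w : int -> R[i]) (x : R).
Local Open Scope complex_scope.
Notation mu := (@lebesgue_measure R).
Notation D := (@freq_itv R).
Notation I h := (\int[mu]_(x in D) h x).

Lemma rdot_le_tail u n N : (N < `|n|)%N ->
  rdot (u n) (u n) <= psumsq u `|n| - psumsq u N.
Proof.
case E: `|n|%N => [//|m]; rewrite ltnS => Nm.
rewrite lerBrDl; apply: (@le_trans _ _ (psumsq u m + rdot (u n) (u n))).
  by rewrite lerD2r psumsq_homo.
rewrite /psumsq symsumS lerD2l.
have [->|->] : n = m.+1%:Z \/ n = - m.+1%:Z by lia.
  by rewrite lerDl rdot_ge0.
by rewrite lerDr rdot_ge0.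
Qed.

(** The terms of a convergent series tend to 0 along any sequence of indices
    that leaves every window. *)
Lemma rdot_cvg0 u (p : nat -> int) : cvgn (psumsq u) -> (forall N, (N <= `|p N|)%N) ->
  (fun N => rdot (u (p N)) (u (p N))) @ \oo --> (0 : R).
Proof.
move=> cu pN; rewrite -cvg_shiftS.
apply: (@squeeze_cvgr _ _ _ _ (fun=> 0) (fun N => limn (psumsq u) - psumsq u N)).
- near=> N; rewrite rdot_ge0 /=; apply: le_trans (rdot_le_tail _ (pN N.+1)) _.
  by rewrite lerD2r nondecreasing_cvgn_le//; exact: psumsq_homo.
- exact: cvg_cst.
- by rewrite -[X in _ --> X](subrr (limn (psumsq u))); apply: cvgB => //; exact: cvg_cst.
Unshelve. all: by end_near. Qed.

Lemma rip_fterm_sq u n :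
  rip (fun x => fterm u x n) (fun x => fterm u x n) = rdot (u n) (u n).
Proof. by rewrite rip_fterms eqxx. Qed.

Lemma ripN f g : rip (fun x => - f x) (fun x => - f x) = rip f f.
Proof.
by apply: eq_I => x _; case: (f x) => a b; rewrite /rdot /=; ring.
Qed.

(** The common part of the two shift rules: the modulus-one factor [e]
    disappears from the L^2 error, and the two boundary terms created by the
    shift have the norms of single coefficients, which tend to 0. *)
Lemma is_fourier_mul u w f e (p q : nat -> int) :
  (forall N, (N <= `|p N|)%N) -> (forall N, (N <= `|q N|)%N) ->
  cmeasurable D e -> (forall x, rdot (e x) (e x) = 1) ->
  (forall N x, fourier_psum w N x =
     e x * (fourier_psum u N x + (fterm u x (p N) - fterm u x (q N)))) ->
  is_fourier u f -> is_fourier w (fun x => e x * f x).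
Proof.
move=> pN qN me e1 wE uf; have cu := is_fourier_psumsq uf.
have /is_fourierP[Lf du] := uf.
apply/is_fourierP; split.
  by apply: (L2_mulb (C := 1)) => // x _; rewrite e1.
have cu' : cvgn (psumsq u) by apply/cvg_ex; eexists; exact: cu.
apply: (@squeeze_cvgr _ _ _ _ (fun=> 0) (fun N => 2 * fourier_err u f N +
  2 * (2 * rdot (u (p N)) (u (p N)) + 2 * rdot (u (q N)) (u (q N))))).
- near=> N; rewrite fourier_err_ge0 /=.
  have Lp := L2_fterm u (p N); have Lq := L2_fterm u (q N).
  have Ls := L2_fourier_psum u N.
  have -> : fourier_err w (fun x => e x * f x) N =
      rip (fun x => (fourier_psum u N x - f x) + (fterm u x (p N) - fterm u x (q N)))
          (fun x => (fourier_psum u N x - f x) + (fterm u x (p N) - fterm u x (q N))).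
    by apply: eq_I => x _; rewrite wE -mulrBr rdotM e1 mul1r addrAC.
  have h1 := ripD_le ltr01 (L2_B Ls Lf) (L2_B Lp Lq).
  have h2 := ripD_le ltr01 Lp (L2_N Lq).
  apply: (le_trans h1); move: h2; rewrite invr1 ripN// !rip_fterm_sq -/(fourier_err u f N).
  by lra.
- exact: cvg_cst.
- rewrite -[X in _ --> X](addr0 0) -[X in _ --> X + _](mulr0 2) -[X in _ --> _ + X](mulr0 2).
  apply: cvgD; first exact: cvgMr.
  apply: cvgMr; rewrite -[X in _ --> X](addr0 0) -[X in _ --> X + _](mulr0 2).
  by rewrite -[X in _ --> _ + X](mulr0 2); apply: cvgD; apply: cvgMr; exact: rdot_cvg0.
Unshelve. all: by end_near. Qed.

Lemma fterm_pred u x n :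
  fterm (fun n => u (n - 1)) x n = expi (- 1 * x) * fterm u x (n - 1).
Proof.
rewrite /fterm (_ : - (n%:~R * x) = - 1 * x + - ((n - 1)%:~R * x)).
  by rewrite expiD; ring.
by rewrite intrB; ring.
Qed.

Lemma fterm_succ u x n :
  fterm (fun n => u (n + 1)) x n = expi (1 * x) * fterm u x (n + 1).
Proof.
rewrite /fterm (_ : - (n%:~R * x) = 1 * x + - ((n + 1)%:~R * x)).
  by rewrite expiD; ring.
by rewrite intrD; ring.
Qed.

Lemma symsum_mul (c : R[i]) (F : int -> R[i]) N :
  symsum (fun n => c * F n) N = c * symsum F N.
Proof. by rewrite /symsum big_distrr. Qed.

Lemma is_fourier_pred u f : is_fourier u f ->
  is_fourier (fun n => u (n - 1)) (fun x => expi (- 1 * x) * f x).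
Proof.
apply: (@is_fourier_mul _ _ _ _ (fun N => - N.+1%:Z) (fun N => N%:Z)).
- by move=> N; lia.
- by move=> N; lia.
- exact: cmeas_expi.
- by move=> x; rewrite rdot_expi.
- move=> N x; rewrite !fourier_psumE -symsum_shift -symsum_mul.
  by apply: eq_symsum => n _; rewrite fterm_pred.
Qed.

Lemma is_fourier_succ u f : is_fourier u f ->
  is_fourier (fun n => u (n + 1)) (fun x => expi (1 * x) * f x).
Proof.
apply: (@is_fourier_mul _ _ _ _ (fun N => N.+1%:Z) (fun N => - N%:Z)).
- by move=> N; lia.
- by move=> N; lia.
- exact: cmeas_expi.
- by move=> x; rewrite rdot_expi.
- move=> N x; rewrite !fourier_psumE.
  have -> : symsum (fterm u x) N = symsum (fun n => fterm u x (n - 1 + 1)) N.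
    by apply: eq_symsum => n _; rewrite subrK.
  rewrite (symsum_shift (fun n => fterm u x (n + 1)) N).
  rewrite (_ : - N.+1%:Z + 1 = - N%:Z); last by lia.
  rewrite (_ : N%:Z + 1 = N.+1%:Z); last by lia.
  rewrite -addrA [X in _ * (_ + X)]addrA subrK subrr addr0 -symsum_mul.
  by apply: eq_symsum => n _; rewrite fterm_succ.
Qed.

Lemma symsumB (F G : int -> R[i]) N :
  symsum (fun n => F n - G n) N = symsum F N - symsum G N.
Proof. by rewrite /symsum sumrB. Qed.

Lemma is_fourierB u w f g : is_fourier u f -> is_fourier w g ->
  is_fourier (fun n => u n - w n) (fun x => f x - g x).
Proof.
move=> /is_fourierP[Lf du] /is_fourierP[Lg dw]; apply/is_fourierP.
split; first exact: L2_B.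
apply: (@squeeze_cvgr _ _ _ _ (fun=> 0) (fun N => 2 * fourier_err u f N + 2 * fourier_err w g N)).
- near=> N; rewrite fourier_err_ge0 /=.
  have Lu := L2_fourier_psum u N; have Lw := L2_fourier_psum w N.
  have := ripD_le ltr01 (L2_B Lu Lf) (L2_N (L2_B Lw Lg)).
  rewrite invr1 ripN//; apply: le_trans; rewrite le_eqVlt; apply/orP; left; apply/eqP.
  apply: eq_I => x _; congr rdot; rewrite !fourier_psumE.
    rewrite (@eq_symsum _ _ (fun n => fterm u x n - fterm w x n)) ?symsumB; first by ring.
    by move=> n _; rewrite /fterm; ring.
  rewrite (@eq_symsum _ _ (fun n => fterm u x n - fterm w x n)) ?symsumB; first by ring.
  by move=> n _; rewrite /fterm; ring.
- exact: cvg_cst.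
- rewrite -[X in _ --> X](addr0 0) -[X in _ --> X + _](mulr0 2) -[X in _ --> _ + X](mulr0 2).
  by apply: cvgD; apply: cvgMr.
Unshelve. all: by end_near. Qed.

Lemma is_fourier_Dop u f : is_fourier u f ->
  is_fourier (Dop u) (fun x => (1 - expi (- 1 * x)) * f x).
Proof.
move=> uf; have := is_fourierB uf (is_fourier_pred uf).
rewrite (_ : (fun x => f x - _) = (fun x => (1 - expi (- 1 * x)) * f x))//.
by apply/funext => x; rewrite mulrBl mul1r.
Qed.

(** The Fourier symbol of the Laplacian. *)
Definition lapsym x : R := 2 - 2 * cos x.

(** The Laplacian is the difference of two backward differences, one of them
    shifted. *)
Lemma is_fourier_Lap u f : is_fourier u f ->
  is_fourier (Lap u) (fun x => (lapsym x)%:C * f x).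
Proof.
move=> uf.
have := is_fourierB (is_fourierB uf (is_fourier_pred uf))
          (is_fourierB (is_fourier_succ uf) uf).
rewrite (_ : (fun n => _) = Lap u); last by apply/funext => n; rewrite /Lap; ring.
rewrite (_ : (fun x => _) = (fun x => (lapsym x)%:C * f x))//.
apply/funext => x; rewrite mul1r mulN1r /expi cosN sinN /lapsym.
by apply/eqP; rewrite eq_complex; case: (f x) => a b /=;
   apply/andP; split; apply/eqP; ring.
Qed.

Lemma is_fourier_iterLap u f (k : nat) : is_fourier u f ->
  is_fourier (iter k Lap u) (fun x => (lapsym x ^+ k)%:C * f x).
Proof.
move=> uf; elim: k => [|k ih].
  rewrite /= (_ : (fun x => _) = f)//.
  by apply/funext => x; rewrite expr0 mul1r.
have := is_fourier_Lap ih.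
rewrite (_ : (fun x => _) = (fun x => (lapsym x ^+ k.+1)%:C * f x))//.
by apply/funext => x; rewrite mulrA -rmorphM -exprS.
Qed.

Lemma lapsym_ge0 x : 0 <= lapsym x.
Proof. by rewrite /lapsym; have := cos_le1 x; lra. Qed.

Lemma lapsym_le4 x : lapsym x <= 4.
Proof. by rewrite /lapsym; have := cos_geN1 x; lra. Qed.

Lemma rdot_1B_expi x : rdot (1 - expi x) (1 - expi x) = lapsym x.
Proof.
rewrite /rdot /= /lapsym.
by have := cos2Dsin2 x; rewrite !expr2; nra.
Qed.

Lemma lapsymN x : lapsym (- x) = lapsym x.
Proof. by rewrite /lapsym cosN. Qed.

Lemma sqsum_iterLap u f (k : nat) : is_fourier u f ->
  sqsum (iter k Lap u) = (I (fun x => lapsym x ^+ (2 * k) * rdot (f x) (f x)))%:E.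
Proof.
move=> uf; rewrite (sqsum_cvg (is_fourier_psumsq (is_fourier_iterLap k uf))).
by congr _%:E; apply: eq_I => x _; rewrite rdot_scale mulrC mul2n -addnn exprD mulrC.
Qed.

Lemma sqsum_Dop_iterLap u f (k : nat) : is_fourier u f ->
  sqsum (Dop (iter k Lap u)) =
  (I (fun x => lapsym x ^+ (2 * k).+1 * rdot (f x) (f x)))%:E.
Proof.
move=> uf.
rewrite (sqsum_cvg (is_fourier_psumsq (is_fourier_Dop (is_fourier_iterLap k uf)))).
congr _%:E; apply: eq_I => x _; rewrite rdotM rdot_1B_expi mulN1r lapsymN rdot_scale.
by rewrite exprS mul2n -addnn exprD; ring.
Qed.

End Operators.

(** * Riesz-Fischer theorem *)

Section RieszFischer.
Context {R : realType}.
Implicit Types (h : R -> R) (f g : R -> R[i]) (u w : int -> R[i]) (x : R).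
Local Open Scope complex_scope.
Notation mu := (@lebesgue_measure R).
Notation D := (@freq_itv R).
Notation I h := (\int[mu]_(x in D) h x).

Lemma limn_einf_le (v : (\bar R)^nat) (c : \bar R) :
  (forall n, v n <= c)%E -> (limn_einf v <= c)%E.
Proof.
move=> vc; rewrite limn_einf_lim; apply: lime_le; first exact: is_cvg_einfs.
by apply: nearW => n; apply: le_trans (vc n); apply: ereal_inf_lbound; exists n => /=.
Qed.

Lemma limn_einf_EFin (v : R^nat) (l : R) : v @ \oo --> l ->
  limn_einf (fun j => (v j)%:E) = l%:E.
Proof.
move=> vl; have vlE : (fun j => (v j)%:E) @ \oo --> l%:E.
  by apply: cvg_EFin; [exact: nearW|exact: vl].
by have [-> _] := cvg_limn_einf_sup vlE.
Qed.

(** The condition [j <= a j] makes the tail of the subsequence start beyond any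
    given index. *)
Lemma fast_subsequence (v : R^nat) (l : R) (e : nat -> R) :
  {homo v : n m / (n <= m)%N >-> n <= m} -> (forall j, 0 < e j) -> v @ \oo --> l ->
  exists a : nat -> nat, [/\ forall j, (j <= a j)%N, forall j, (a j <= a j.+1)%N &
    forall j, l - v (a j) <= e j].
Proof.
move=> hv e0 vl.
have /choice[A lA] : forall j, exists N, l - v N < e j.
  move=> j.
  have /cvgrPdist_lt /(_ _ (e0 j))[N _ /(_ N (leqnn N))] := vl.
  by move/(le_lt_trans (ler_norm _)) => ?; exists N.
exists (fun j => j + \sum_(i < j.+1) A i)%N; split=> [j|j|j].
- by rewrite leq_addr.
- by rewrite [X in (_ <= _ + X)%N]big_ord_recr /= leq_add ?leq_addr.
- apply: le_trans (ltW (lA j)); rewrite lerD2l lerN2 hv//.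
  by rewrite big_ord_recr /= addnA leq_addl.
Qed.

(** This replaces the Cauchy-Schwarz inequality in bounding L^1 norms by L^2
    norms on the interval. *)
Lemma abs_le_young (s e : R) : 0 < e -> `|s| <= e / 2 + s * s / (2 * e).
Proof.
move=> e0; rewrite -(@ler_pM2l _ (2 * e)) ?mulr_gt0//.
have -> : 2 * e * (e / 2 + s * s / (2 * e)) = e * e + s * s by field; rewrite gt_eqF.
rewrite -[s * s]expr2 -real_normK ?num_real//.
by have := sqr_ge0 (e - `|s|); rewrite !expr2; lra.
Qed.

Lemma cvgn_abs_increments (v : R^nat) (B : R) :
  (forall n, \sum_(j < n) `|v j - v j.+1| <= B) -> cvgn v.
Proof.
move=> vB.
have : cvgn (series (telescope v) : R^o^nat).
  apply: normed_cvg; apply: nondecreasing_is_cvgn.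
    by apply: nondecreasing_series => n _ _; exact: normr_ge0.
  exists B => _ [n _ <-]; apply: le_trans (vB n).
  rewrite -(big_mkord xpredT (fun j => `|v j - v j.+1|)).
  by apply: ler_sum => j _; rewrite /telescope distrC.
move=> ct; rewrite (_ : v = (fun n => v 0%N + series (telescope v) n)).
  by apply: is_cvgD => //; exact: is_cvg_cst.
by apply/funext => n; exact: eq_sum_telescope.
Qed.

Lemma sum_half_le2 n : \sum_(j < n) (2 ^- j : R) <= 2.
Proof.
suff -> : \sum_(j < n) (2 ^- j : R) = 2 - 2 * 2 ^- n.
  by rewrite lerBlDr lerDl mulr_ge0// invr_ge0 exprn_ge0.
elim: n => [|n ih]; first by rewrite big_ord0 expr0 invr1 mulr1 subrr.
rewrite big_ord_recr /= ih exprS invfM.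
by set t := _ ^- _; lra.
Qed.

(** The increments are measured coordinatewise, so that their summability gives
    the convergence of the real and imaginary parts separately. *)
Definition incr (T : nat -> R -> R[i]) j x : R :=
  `|complex.Re (T j x) - complex.Re (T j.+1 x)| +
  `|complex.Im (T j x) - complex.Im (T j.+1 x)|.

Lemma incr_ge0 (T : nat -> R -> R[i]) j x : 0 <= incr T j x.
Proof. by rewrite addr_ge0. Qed.

Lemma measurable_incr (T : nat -> R -> R[i]) j : (forall j, L2 (T j)) ->
  measurable_fun D (incr T j).
Proof.
move=> LT; have [[r i] _] := LT j; have [[r' i'] _] := LT j.+1.
by apply: measurable_funD; apply: measurableT_comp => //; exact: measurable_funB.
Qed.

(** Young's inequality with parameter [2^-j] balances an L^2 increment of square
    [4^-j] against the measure of the interval. *)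
Lemma integral_incr_le (T : nat -> R -> R[i]) j : (forall j, L2 (T j)) ->
  rip (fun x => T j x - T j.+1 x) (fun x => T j x - T j.+1 x) <= 4 ^- j ->
  (\int[mu]_(x in D) (incr T j x)%:E <= ((2 * pi + 1) * 2 ^- j)%:E)%E.
Proof.
move=> LT Tj; have Ld := L2_B (LT j) (LT j.+1); have [_ jd] := Ld.
set d := fun x => T j x - T j.+1 x in Tj Ld jd.
have e0 : 0 < 2 ^- j :> R by rewrite invr_gt0 exprn_gt0.
have jb : L1 (fun x => 2 ^- j + 2 ^+ j * rdot (d x) (d x)).
  by apply: L1_D; [exact: L1_cst|exact: L1_Z].
have le_b x : incr T j x <= 2 ^- j + 2 ^+ j * rdot (d x) (d x).
  rewrite /incr /d /rdot; case: (T j x) (T j.+1 x) => [a b] [c t] /=.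
  have := abs_le_young (a - c) e0; have := abs_le_young (b - t) e0.
  rewrite !(invfM 2) invrK.
  have : 0 < 2 ^+ j :> R by rewrite exprn_gt0.
  set q := 2 ^+ j; set p := 2 ^- j => q0.
  have := mulr_ge0 (ltW q0) (sqr_ge0 (a - c)).
  have := mulr_ge0 (ltW q0) (sqr_ge0 (b - t)).
  by rewrite !expr2; set A := _ * (_ * _); set B := _ * (_ * _); rewrite /A /B; nra.
have jT : L1 (incr T j).
  apply: (L1_le _ _ jb); first exact: measurable_incr.
  by move=> x _; rewrite ger0_norm ?incr_ge0.
rewrite -[leLHS]fineK; last exact: integrable_fin_num.
rewrite lee_fin; apply: (@le_trans _ _ (I (fun x => 2 ^- j + 2 ^+ j * rdot (d x) (d x)))).
  exact: le_I.
rewrite I_D//; [|exact: L1_cst|exact: L1_Z].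
rewrite (I_Z _ jd) I_cst (mulrDl (2 * pi)) mul1r (mulrC (2 * pi)) lerD2l.
apply: (@le_trans _ _ (2 ^+ j * 4 ^- j)).
  by rewrite ler_pM2l ?exprn_gt0.
have -> : 4 = 2 * 2 :> R by ring.
by rewrite exprMn invfM mulrA divff ?mul1r// expf_neq0.
Qed.

(** The increments have a finite integral in total, so their sum is finite
    outside a null set. *)
Lemma ae_cvg_fast (T : nat -> R -> R[i]) : (forall j, L2 (T j)) ->
  (forall j, rip (fun x => T j x - T j.+1 x) (fun x => T j x - T j.+1 x) <= 4 ^- j) ->
  exists N : set R, [/\ measurable N, mu N = 0%E & forall x, D x -> ~ N x ->
    cvgn (fun j => complex.Re (T j x)) /\ cvgn (fun j => complex.Im (T j x))].
Proof.
move=> LT hT.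
pose G x : \bar R := (\sum_(0 <= j <oo) (incr T j x)%:E)%E.
have i0 j x : (0 <= (incr T j x)%:E)%E by rewrite lee_fin incr_ge0.
have mi j : measurable_fun D (fun x => (incr T j x)%:E).
  by apply/measurable_EFinP; exact: measurable_incr.
have mG : measurable_fun D G.
  apply: (emeasurable_fun_cvg (fun n x => (\sum_(0 <= j < n) (incr T j x)%:E)%E)).
    by move=> n; apply: emeasurable_sum.
  by move=> x Dx; apply: is_cvg_nneseries.
have G0 x : (0 <= G x)%E by apply: nneseries_ge0.
have jG : mu.-integrable D G.
  apply/integrableP; split => //.
  under eq_integral do rewrite gee0_abs//.
  rewrite integral_nneseries//.
  apply: (@le_lt_trans _ _ ((2 * pi + 1) * 2)%:E); last exact: ltry.
  apply: lime_le; first by apply: is_cvg_nneseries => j _ _; apply: integral_ge0.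
  apply: nearW => n; rewrite big_mkord.
  apply: (@le_trans _ _ (\sum_(j < n) ((2 * pi + 1) * 2 ^- j)%:E)%E).
    by apply: lee_sum => j _; apply: integral_incr_le.
  rewrite sumEFin lee_fin -mulr_sumr ler_wpM2l ?sum_half_le2//.
  by rewrite addr_ge0// mulr_ge0// pi_ge0.
have [N [mN N0 GN]] : {ae mu, forall x, D x -> G x \is a fin_num}.
  by apply: integrable_ae jG.
exists N; split=> // x Dx Nx.
have Gf : G x \is a fin_num.
  by apply: contrapT => Gx; apply: Nx; apply: GN => /= /(_ Dx).
have sB n : \sum_(j < n) incr T j x <= fine (G x).
  rewrite -lee_fin fineK// -sumEFin -(big_mkord xpredT (fun j => (incr T j x)%:E)).
  exact: nneseries_lim_ge.
split; apply: (@cvgn_abs_increments _ (fine (G x))) => n; apply: le_trans (sB n);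
  apply: ler_sum => j _; rewrite /incr.
  by rewrite lerDl.
by rewrite lerDr.
Qed.

Lemma cvg_rdot (z : nat -> R[i]) (c l : R[i]) :
  (fun j => complex.Re (z j)) @ \oo --> complex.Re l ->
  (fun j => complex.Im (z j)) @ \oo --> complex.Im l ->
  (fun j => rdot (c - z j) (c - z j)) @ \oo --> rdot (c - l) (c - l).
Proof.
have E (w : R[i]) : rdot (c - w) (c - w) =
    (complex.Re c - complex.Re w) * (complex.Re c - complex.Re w) +
    (complex.Im c - complex.Im w) * (complex.Im c - complex.Im w).
  by case: c w => [a b] [p q].
move=> rz iz; rewrite E; under eq_fun do rewrite E.
by apply: cvgD; apply: cvgM; apply: cvgB => //; exact: cvg_cst.
Qed.

Lemma integral_setD_null h (N : set R) : measurable N -> mu N = 0%E ->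
  measurable_fun D h -> (forall x, 0 <= h x) ->
  (\int[mu]_(x in D) (h x)%:E = \int[mu]_(x in D `\` N) (h x)%:E)%E.
Proof.
move=> mN N0 mh h0; apply: ge0_negligible_integral => //.
  exact/measurable_EFinP.
by move=> x _; rewrite lee_fin.
Qed.

(** The limit is taken off the exceptional null set and put to 0 on it, which
    makes it measurable; Fatou's lemma along the subsequence bounds its distance
    to each partial sum by the corresponding tail of the series. *)
Lemma riesz_fischer u : cvgn (psumsq u) -> exists f, is_fourier u f.
Proof.
move=> cu; set l := limn (psumsq u).
have uh := @psumsq_homo _ u.
have ul N : psumsq u N <= l by apply: nondecreasing_cvgn_le.
have e0 j : 0 < 4 ^- j :> R by rewrite invr_gt0 exprn_gt0.
have [a [ja aS la]] := fast_subsequence uh e0 cu.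
pose T j := fourier_psum u (a j).
have LT j : L2 (T j) by exact: L2_fourier_psum.
have hT j : rip (fun x => T j x - T j.+1 x) (fun x => T j x - T j.+1 x) <= 4 ^- j.
  by rewrite rip_psum_diff//; apply: le_trans (la j); rewrite lerD2r.
have [N [mN N0 cN]] := ae_cvg_fast LT hT.
pose F (q : R[i] -> R) x : R := limn (fun j => q (T j x) * \1_(~` N) x).
pose f x : R[i] := F (@complex.Re R) x +i* F (@complex.Im R) x.
have cF (q : R[i] -> R) :
    (forall x, D x -> ~ N x -> cvgn (fun j => q (T j x))) -> forall x, D x ->
    (fun j => q (T j x) * \1_(~` N) x) @ \oo --> F q x.
  move=> cq x Dx; have [Nx|Nx] := pselect (N x).
    rewrite /F (_ : (fun j => _) = fun=> 0); first exact: is_cvg_cst.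
    by apply/funext => j; rewrite indicE memNset ?mulr0//= => /(_ Nx).
  apply: is_cvgMl; exact: cq.
have cR := cF _ (fun x Dx Nx => (cN x Dx Nx).1).
have cI := cF _ (fun x Dx Nx => (cN x Dx Nx).2).
have mi : measurable_fun D (\1_(~` N) : R -> R).
  by apply: measurable_funTS; apply: measurable_indic; exact: measurableC.
have mf : cmeasurable D f.
  split; [apply: (measurable_fun_cvg _ cR)|apply: (measurable_fun_cvg _ cI)] => j;
    by have [[mr mj] _] := LT j; apply: measurable_funM.
have key M : (\int[mu]_(x in D) (rdot (fourier_psum u M x - f x)
    (fourier_psum u M x - f x))%:E <= (l - psumsq u M)%:E)%E.
  have LS := L2_fourier_psum u M.
  have mS : cmeasurable D (fun x => - f x).
    rewrite (_ : (fun x => _) = (fun x => (-1) * f x)).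
      by apply: cmeasM => //; exact: cmeas_cst.
    by apply/funext => x; rewrite mulN1r.
  have mrd : measurable_fun D (fun x => rdot (fourier_psum u M x - f x)
    (fourier_psum u M x - f x)).
    by apply: measurable_rdot; apply: cmeasD => //; case: LS.
  (* Fatou's lemma is applied off the null set, where the convergence is pointwise. *)
  rewrite (integral_setD_null mN N0 mrd); last by move=> x; exact: rdot_ge0.
  (* The index starts at [M], so that [a (M + j) >= M] and the error is a tail. *)
  pose h j x := (rdot (fourier_psum u M x - T (M + j)%N x)
                    (fourier_psum u M x - T (M + j)%N x))%:E.
  have mDN : measurable (D `\` N) by exact: measurableD.
  have mh j : measurable_fun D (h j).
    by apply/measurable_EFinP; apply: measurable_rdot; case: (L2_B LS (LT (M + j)%N)).
  have hE x : (D `\` N) x -> (rdot (fourier_psum u M x - f x)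
      (fourier_psum u M x - f x))%:E = limn_einf (h^~ x).
    move=> [Dx Nx]; apply/esym/limn_einf_EFin.
    have E1 q : (fun j => q (T j x) * \1_(~` N) x) = (fun j => q (T j x) : R).
      by apply/funext => j; rewrite indicE mem_set ?mulr1.
    have := cR x Dx; have := cI x Dx; rewrite !E1 => {}cI {}cR.
    have c1 : (fun j => complex.Re (T (M + j)%N x)) @ \oo --> complex.Re (f x).
      by apply: (cvg_comp _ _ (cvg_addnl M) cR).
    have c2 : (fun j => complex.Im (T (M + j)%N x)) @ \oo --> complex.Im (f x).
      by apply: (cvg_comp _ _ (cvg_addnl M) cI).
    exact: cvg_rdot.
  rewrite (eq_mu hE).
  have h0 j x : (0 <= h j x)%E by rewrite lee_fin rdot_ge0.
  apply: le_trans (fatou mu mDN _ _) _.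
  - by move=> n; apply: measurable_funS (mh n) => //; exact: subDsetl.
  - by move=> n x _; exact: h0.
  apply: limn_einf_le => j.
  apply: (@le_trans _ _ (\int[mu]_(x in D) h j x)%E).
    apply: ge0_subset_integral.
    - exact: mDN.
    - exact: measurable_freq.
    - exact: mh.
    - by move=> x _; exact: h0.
    - exact: subDsetl.
  have -> : (\int[mu]_(x in D) h j x = (psumsq u (a (M + j)%N) - psumsq u M)%:E)%E.
    rewrite -rip_psum_diff; last by apply: leq_trans (ja _); exact: leq_addr.
    rewrite -integral_rip; last by apply: L2_B => //; exact: LT.
    by apply: eq_mu => x _; rewrite normc_sqE.
  by rewrite lee_fin lerD2r.
have LSf M : L2 (fun x => fourier_psum u M x - f x).
  have LS := L2_fourier_psum u M.
  apply/L2P; split.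
    apply: cmeasD; first by case: LS.
    rewrite (_ : (fun x => _) = (fun x => (-1) * f x)).
      by apply: cmeasM => //; exact: cmeas_cst.
    by apply/funext => x; rewrite mulN1r.
  under eq_integral do rewrite normc_sqE.
  by apply: le_lt_trans (key M) (ltry _).
have Lf : L2 f.
  rewrite (_ : f = fun x => fourier_psum u 0 x - (fourier_psum u 0 x - f x)).
    by apply: L2_B => //; exact: L2_fourier_psum.
  by apply/funext => x; rewrite opprB addrC subrK.
exists f; apply/is_fourierP; split=> //.
apply: (@squeeze_cvgr _ _ _ _ (fun=> 0) (fun N => l - psumsq u N)).
- near=> M; rewrite fourier_err_ge0 /= -lee_fin -integral_rip//.
  by under eq_integral do rewrite normc_sqE; exact: key.
- exact: cvg_cst.
- by rewrite -[X in _ --> X](subrr l); apply: cvgB => //; exact: cvg_cst.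
Unshelve. all: by end_near. Qed.

End RieszFischer.

(** * Fejer means and completeness for lower semicontinuous functions *)

Section FejerKernel.
Context {R : realType}.
Implicit Types (t x y : R) (n : nat).
Local Open Scope complex_scope.
Notation mu := (@lebesgue_measure R).
Notation D := (@freq_itv R).
Notation I h := (\int[mu]_(x in D) h x).

(** The squared modulus of a geometric sum of exponentials, that is [2 pi n]
    times the Fejer kernel of integral 1. *)
Definition fejer_ker n t : R :=
  \sum_(j < n) \sum_(l < n) cos ((j%:Z - l%:Z)%:~R * t).

Lemma fejer_ker_rdot n t : fejer_ker n t =
  rdot (\sum_(j < n) expi (j%:R * t)) (\sum_(l < n) expi (l%:R * t)).
Proof.
rewrite rdot_suml; apply: eq_bigr => j _; rewrite rdotC rdot_suml.
apply: eq_bigr => l _; rewrite intrB mulrBl cosB /rdot /=.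
by rewrite mulrC [X in _ + X]mulrC.
Qed.

Lemma fejer_ker_ge0 n t : 0 <= fejer_ker n t.
Proof. by rewrite fejer_ker_rdot rdot_ge0. Qed.

Lemma geom_expi n t :
  (1 - expi t) * (\sum_(j < n) expi (j%:R * t)) = 1 - expi (n%:R * t) :> R[i].
Proof.
elim: n => [|n ih]; first by rewrite big_ord0 mulr0 mul0r expi0 subrr.
by rewrite big_ord_recr /= mulrDr ih -natr1 (mulrDl n%:R) mul1r expiD; ring.
Qed.

(** Multiplying the geometric sum by [1 - e^{it}] telescopes it to [1 - e^{int}].
    This bound is what concentrates the kernel near 0. *)
Lemma fejer_ker_lapsym n t : lapsym t * fejer_ker n t <= 4.
Proof. by rewrite fejer_ker_rdot -rdot_1B_expi -rdotM geom_expi rdot_1B_expi lapsym_le4. Qed.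

Lemma sum_ord_le n (F : 'I_n -> R) (c : R) : (forall j, F j <= c) ->
  \sum_j F j <= n%:R * c.
Proof.
move=> Fc; rewrite [leRHS]mulr_natl -[X in _ *+ X]card_ord -sumr_const.
exact: ler_sum.
Qed.

Lemma fejer_ker_abs_le n t : `|fejer_ker n t| <= n%:R * n%:R.
Proof.
apply: le_trans (ler_norm_sum _ _ _) _; apply: sum_ord_le => j.
apply: le_trans (ler_norm_sum _ _ _) _; rewrite -[leRHS]mulr1.
by apply: sum_ord_le => l; rewrite ler_norml cos_geN1 cos_le1.
Qed.

Lemma measurable_cosMB (a y : R) : measurable_fun D (fun x => cos (a * (x - y))).
Proof.
apply: measurable_funTS; apply: continuous_measurable_fun => x.
apply: continuous_comp; last exact: continuous_cos.
by apply: cvgM; [exact: cvg_cst|apply: cvgB; [exact: cvg_id|exact: cvg_cst]].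
Qed.

Lemma L1_cosMB (a y : R) : L1 (fun x => cos (a * (x - y))).
Proof.
apply: (L1_bounded (C := 1)); first exact: measurable_cosMB.
by move=> x _; rewrite ler_norml cos_geN1 cos_le1.
Qed.

Lemma L1_cosM (a : R) : L1 (fun x => cos (a * x)).
Proof.
apply: (L1_bounded (C := 1)); first exact: measurable_cosM.
by move=> x _; rewrite ler_norml cos_geN1 cos_le1.
Qed.

Lemma L1_sinM (a : R) : L1 (fun x => sin (a * x)).
Proof.
apply: (L1_bounded (C := 1)); first exact: measurable_sinM.
by move=> x _; rewrite ler_norml sin_geN1 sin_le1.
Qed.

Lemma L1_fejer_ker n y : L1 (fun x => fejer_ker n (x - y)).
Proof. by apply: L1_sum => j; apply: L1_sum => l; exact: L1_cosMB. Qed.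

Lemma I_fejer_ker n y : I (fun x => fejer_ker n (x - y)) = n%:R * (2 * pi).
Proof.
rewrite I_sum; last by move=> j; apply: L1_sum => l; exact: L1_cosMB.
rewrite (eq_bigr (fun=> 2 * pi)).
  by rewrite sumr_const card_ord [RHS]mulr_natl.
move=> j _; rewrite I_sum; last by move=> l; exact: L1_cosMB.
rewrite (bigD1 j) //= big1 ?addr0 => [|l lj].
  rewrite subrr (@eq_I _ _ (fun=> 1)); first by rewrite I_cst mul1r.
  by move=> x _; rewrite mul0r cos0.
set m := j%:Z - l%:Z.
rewrite (@eq_I _ _ (fun x => cos (m%:~R * y) * cos (m%:~R * x) +
   sin (m%:~R * y) * sin (m%:~R * x))); last first.
  by move=> x _; rewrite mulrBr cosB; ring.
rewrite I_D; [|by apply: L1_Z; exact: L1_cosM|by apply: L1_Z; exact: L1_sinM].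
rewrite I_Z; last exact: L1_cosM.
rewrite I_Z; last exact: L1_sinM.
rewrite I_cosM I_sinM ifN ?mulr0 ?addr0// /m subr_eq0.
by apply: contra lj => /eqP[jl]; apply/eqP; apply: val_inj.
Qed.

End FejerKernel.

Section FejerMeans.
Context {R : realType}.
Implicit Types (x y : R) (n : nat).
Local Open Scope complex_scope.
Notation mu := (@lebesgue_measure R).
Notation D := (@freq_itv R).
Notation I h := (\int[mu]_(x in D) h x).

Context (g : R -> R) (gL2 : L2 (fun x => (g x)%:C)) (g0 : forall x, 0 <= g x).
Context (glsc : forall y t : R, D y -> 0 <= t -> t < g y ->
  exists2 d : R, 0 < d & forall x, D x -> `|x - y| < d -> t < g x).

Let v := inv_fourier (fun x => (g x)%:C).

Let jg : L1 g. Proof. by have [] := L2_ReIm gL2. Qed.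

Let mg : measurable_fun D g. Proof. exact: L1_measurable. Qed.

Let jgg : L1 (fun x => g x * g x).
Proof.
have [_] := gL2; apply: L1_ext => x _.
by rewrite /rdot /= mulr0 addr0.
Qed.

Let cosc (m : int) : R := I (fun x => cos (m%:~R * x) * g x).
Let sinc (m : int) : R := I (fun x => sin (m%:~R * x) * g x).

Let jcosg (m : int) : L1 (fun x => cos (m%:~R * x) * g x).
Proof.
apply: (L1_mulb (C := 1) jg); first exact: measurable_cosM.
by move=> x _; rewrite ler_norml cos_geN1 cos_le1.
Qed.

Let jsing (m : int) : L1 (fun x => sin (m%:~R * x) * g x).
Proof.
apply: (L1_mulb (C := 1) jg); first exact: measurable_sinM.
by move=> x _; rewrite ler_norml sin_geN1 sin_le1.
Qed.

(** Since [g] is real, a coefficient splits into its cosine and sine parts. *)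
Lemma rdot_coef m : rdot (v m) (v m) = rsqrt2pi * rsqrt2pi * (cosc m ^+ 2 + sinc m ^+ 2).
Proof.
rewrite /v /inv_fourier -/rsqrt2pi rdot_scale /cintegral /rdot /= -!expr2.
congr (_ * (_ ^+ 2 + _ ^+ 2)); apply: eq_I => x _ /=; ring.
Qed.

(** The Fejer mean is written as a trigonometric polynomial, which makes it
    measurable and integrable against [g] without a double integral;
    [fejer_meanE] recovers the convolution. *)
Definition fejer_mean n y : R := (n%:R * (2 * pi))^-1 *
  \sum_(j < n) \sum_(l < n) (cosc (j%:Z - l%:Z) * cos ((j%:Z - l%:Z)%:~R * y) +
                             sinc (j%:Z - l%:Z) * sin ((j%:Z - l%:Z)%:~R * y)).

Lemma fejer_meanE n y :
  fejer_mean n y = (n%:R * (2 * pi))^-1 * I (fun x => fejer_ker n (x - y) * g x).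
Proof.
congr (_ * _); have jc a : L1 (fun x => cos (a * (x - y)) * g x).
  apply: (L1_mulb (C := 1) jg); first exact: measurable_cosMB.
  by move=> x _; rewrite ler_norml cos_geN1 cos_le1.
rewrite (@eq_I _ _ (fun x => \sum_(j < n) \sum_(l < n)
   (cos ((j%:Z - l%:Z)%:~R * (x - y)) * g x))); last first.
  by move=> x _; rewrite /fejer_ker mulr_suml; apply: eq_bigr => j _; rewrite mulr_suml.
rewrite I_sum => [|j]; last by apply: L1_sum => l; exact: jc.
apply: eq_bigr => j _; rewrite I_sum => [|l]; last exact: jc.
apply: eq_bigr => l _; set m := j%:Z - l%:Z.
rewrite mulrC [X in _ + X]mulrC /cosc /sinc -!I_Z// -I_D; try exact: L1_Z.
by apply: eq_I => x _; rewrite mulrBr cosB; ring.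
Qed.

Lemma fejer_mean_ge0 n y : 0 <= fejer_mean n y.
Proof.
rewrite fejer_meanE mulr_ge0 ?invr_ge0//.
  by rewrite !mulr_ge0// pi_ge0.
by apply: Rintegral_ge0 => x _; rewrite mulr_ge0 ?fejer_ker_ge0.
Qed.

Lemma L1_g_fejer_mean n : L1 (fun y => g y * fejer_mean n y).
Proof.
rewrite (_ : (fun y => _) = (fun y => (n%:R * (2 * pi))^-1 *
  \sum_(j < n) \sum_(l < n) (cosc (j%:Z - l%:Z) * (cos ((j%:Z - l%:Z)%:~R * y) * g y) +
                  sinc (j%:Z - l%:Z) * (sin ((j%:Z - l%:Z)%:~R * y) * g y)))).
  apply: L1_Z; apply: L1_sum => j; apply: L1_sum => l.
  by apply: L1_D; apply: L1_Z.
apply/funext => y; rewrite /fejer_mean mulrCA; congr (_ * _).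
rewrite mulr_sumr; apply: eq_bigr => j _; rewrite mulr_sumr.
by apply: eq_bigr => l _; ring.
Qed.

Lemma I_g_fejer_mean n : (0 < n)%N -> I (fun y => g y * fejer_mean n y) =
  n%:R^-1 * \sum_(j < n) \sum_(l < n) rdot (v (j%:Z - l%:Z)) (v (j%:Z - l%:Z)).
Proof.
move=> n0.
rewrite (@eq_I _ _ (fun y => (n%:R * (2 * pi))^-1 *
  \sum_(j < n) \sum_(l < n) (cosc (j%:Z - l%:Z) * (cos ((j%:Z - l%:Z)%:~R * y) * g y) +
                  sinc (j%:Z - l%:Z) * (sin ((j%:Z - l%:Z)%:~R * y) * g y)))); last first.
  move=> y _; rewrite /fejer_mean mulrCA; congr (_ * _).
  rewrite mulr_sumr; apply: eq_bigr => j _; rewrite mulr_sumr.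
  by apply: eq_bigr => l _; ring.
have jt (m : int) : L1 (fun y => cosc m * (cos (m%:~R * y) * g y) +
    sinc m * (sin (m%:~R * y) * g y)) by apply: L1_D; apply: L1_Z.
rewrite I_Z; last by apply: L1_sum => j; apply: L1_sum => l; exact: jt.
rewrite I_sum => [|j]; last by apply: L1_sum => l; exact: jt.
rewrite !mulr_sumr; apply: eq_bigr => j _.
rewrite I_sum => [|l]; last exact: jt.
rewrite !mulr_sumr; apply: eq_bigr => l _.
rewrite I_D ?I_Z//; try exact: L1_Z.
have p0 : 2 * pi != 0 :> R by rewrite mulf_neq0 ?gt_eqF ?pi_gt0.
have nrmE : (2 * pi)^-1 = rsqrt2pi * rsqrt2pi :> R.
  by apply: (mulIf p0); rewrite mulVf// nrm_sq.
by rewrite rdot_coef -/(cosc _) -/(sinc _) invfM nrmE !expr2 !mulrA; ring.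
Qed.

(** The shifted window of length [n] lies inside the symmetric one. *)
Lemma sum_shift_le_symsum (a : int -> R) n (l : nat) : (l <= n)%N ->
  (forall m, 0 <= a m) -> \sum_(j < n) a (j%:Z - l%:Z) <= symsum a n.
Proof.
move=> ln a0; rewrite /symsum -(big_mkord xpredT (fun j : nat => a (j%:Z - n%:Z))).
rewrite (@big_cat_nat _ _ _ (n - l)%N)/=; [|by []|by rewrite -addnn; lia].
rewrite (@big_cat_nat _ _ _ (n + (n - l))%N (n - l)%N)/=; [|by lia|by rewrite -addnn; lia].
rewrite ler_wpDl ?sumr_ge0// ler_wpDr ?sumr_ge0//.
rewrite -[X in index_iota X]add0n big_addn addnK big_mkord le_eqVlt.
by apply/orP; left; apply/eqP; apply: eq_bigr => j _; congr a; lia.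
Qed.

Lemma I_g_fejer_mean_le n : (0 < n)%N -> I (fun y => g y * fejer_mean n y) <= psumsq v n.
Proof.
move=> n0; have nR : 0 < n%:R :> R by rewrite ltr0n.
rewrite I_g_fejer_mean// ler_pdivrMl// mulr_natl exchange_big /=.
apply: (@le_trans _ _ (\sum_(l < n) psumsq v n)); last by rewrite sumr_const card_ord.
apply: ler_sum => l _.
apply: (@sum_shift_le_symsum (fun m => rdot (v m) (v m))) => [|m]; last exact: rdot_ge0.
exact/ltnW.
Qed.

(** The condition says that [s] is at distance at least [d] from every multiple
    of [2 pi] in the range where it can lie. *)
Lemma cos_le_of_far (d s : R) : 0 <= d -> d <= `|s| -> `|s| <= 2 * pi - d ->
  cos s <= cos d.
Proof.
move=> d0 ds s2; rewrite -(cos_norm s).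
have dpi : d <= pi by lra.
case: (leP `|s| pi) => spi.
  by rewrite leNgt ltr_cos ?in_itv/= ?normr_ge0 ?d0 ?dpi ?spi// -leNgt.
have -> : cos `|s| = cos (2 * pi - `|s|).
  by rewrite -[RHS]cosN opprB -(cosD2pi (`|s| - 2 * pi)); congr cos; rewrite mulr_natl subrK.
rewrite leNgt ltr_cos ?in_itv/= -?leNgt ?d0 ?dpi//; first by lra.
by apply/andP; split; lra.
Qed.

(** Near [y] lower semicontinuity gives [t < g x]; elsewhere the symbol
    [2 - 2 cos (x - y)] is bounded below, because [x - y] also stays away from
    [2 pi] and [- 2 pi] when [y] is interior, and a large multiple of it
    absorbs [t]. *)
Lemma korovkin_lower y t : D y -> 0 <= t -> t < g y ->
  exists2 C, 0 <= C & forall x, D x -> t - C * lapsym (x - y) <= g x.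
Proof.
move=> Dy t0 tg; have [d d0 dg] := glsc Dy t0 tg.
have := Dy; rewrite /freq_itv /= in_itv /= => /andP[y1 y2].
have ay : `|y| < pi by rewrite ltr_norml y1 y2.
(* With this radius, [e <= |x - y|] also implies [|x - y| <= 2 pi - e]. *)
pose e := Num.min d (pi - `|y|).
have e0 : 0 < e by rewrite lt_min d0 subr_gt0.
have epi : e <= pi by rewrite ge_min; apply/orP; right; rewrite gerBl.
have ce : 0 < lapsym e.
  rewrite /lapsym subr_gt0 -[ltRHS]mulr1 ltr_pM2l// -cos0.
  by rewrite ltr_cos ?in_itv/= ?lexx ?pi_ge0 ?(ltW e0)//.
exists (t / lapsym e); first by rewrite divr_ge0// ltW.
move=> x Dx; have := Dx; rewrite /freq_itv /= in_itv /= => /andP[x1 x2].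
have [xy|xy] := ltP `|x - y| e.
  have tx : t < g x by apply: dg => //; apply: (lt_le_trans xy); rewrite ge_min lexx.
  apply: (le_trans _ (ltW tx)); rewrite gerBl mulr_ge0 ?lapsym_ge0//.
  by rewrite divr_ge0// ltW.
apply: le_trans (g0 x); rewrite subr_le0 mulrAC ler_pdivlMr// ler_wpM2l//.
rewrite /lapsym lerD2l lerN2 ler_pM2l//; apply: cos_le_of_far => //; first exact: ltW.
have ax : `|x| < pi by rewrite ltr_norml x1 x2.
apply: (le_trans (ler_normB _ _)).
have : e <= pi - `|y| by rewrite ge_min lexx orbT.
by lra.
Qed.

(** The Fejer mean of a constant is that constant, while the mean of
    [2 - 2 cos (x - y)] is at most of order [1 / n] by [fejer_ker_lapsym]. *)
Lemma fejer_mean_lower y t : D y -> 0 <= t -> t < g y ->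
  exists C, forall n, (0 < n)%N -> t - C / n%:R <= fejer_mean n y.
Proof.
move=> Dy t0 tg; have [C C0 gC] := korovkin_lower Dy t0 tg.
exists (C * 4); move=> n n0; have nR : 0 < n%:R :> R by rewrite ltr0n.
have p0 : 0 < 2 * pi :> R by rewrite mulr_gt0 ?pi_gt0.
have jk := L1_fejer_ker n y.
have jkg : L1 (fun x => fejer_ker n (x - y) * g x).
  have bk x : `|fejer_ker n (x - y)| <= n%:R * n%:R.
    exact: fejer_ker_abs_le.
  apply: (L1_mulb jg) => [|x _]; last exact: bk.
  exact: L1_measurable.
rewrite fejer_meanE -(ler_pM2l (mulr_gt0 nR p0)) [leRHS]mulrA divff ?mul1r; last first.
  by rewrite gt_eqF// mulr_gt0.
apply: (@le_trans _ _ (I (fun x => t * fejer_ker n (x - y) - C * 4))); last first.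
  apply: le_I => //; first by apply: L1_B; [exact: L1_Z|exact: L1_cst].
  move=> x Dx; have k0 := fejer_ker_ge0 n (x - y).
  have := fejer_ker_lapsym n (x - y); have := gC x Dx.
  have := ler_wpM2l k0 (gC x Dx) => h1 _ h2.
  apply: le_trans h1; rewrite mulrBr mulrC lerD2l lerN2 mulrCA ler_wpM2l//.
  by rewrite mulrC.
rewrite I_B; [|exact: L1_Z|exact: L1_cst].
rewrite I_Z// I_fejer_ker I_cst le_eqVlt; apply/orP; left; apply/eqP.
by field; rewrite gt_eqF.
Qed.

Lemma le_limn_einf (w : R^nat) (c : R) :
  (forall e, 0 < e -> \forall n \near \oo, c - e <= w n) ->
  (c%:E <= limn_einf (fun n => (w n)%:E))%E.
Proof.
move=> cw; apply/lee_addgt0Pr => e e0.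
rewrite -leeBlDr// limn_einf_lim; apply: lime_ge; first exact: is_cvg_einfs.
have [N _ NP] := cw _ e0.
exists N => // n Nn; apply: le_ereal_inf_tmp => _ [m nm <-].
by rewrite -EFinB lee_fin; apply: NP => /=; exact: leq_trans nm.
Qed.

Lemma measurable_limn_einf (F : nat -> R -> \bar R) :
  (forall n, measurable_fun D (F n)) -> measurable_fun D (fun x => limn_einf (F^~ x)).
Proof.
move=> mF; apply: (emeasurable_fun_cvg (fun n x => einfs (F^~ x) n)).
  exact: measurable_fun_einfs.
by move=> x _; rewrite limn_einf_lim; exact: is_cvg_einfs.
Qed.

Lemma sq_le_limn_einf y : D y ->
  ((g y * g y)%:E <= limn_einf (fun n => (g y * fejer_mean n.+1 y)%:E))%E.
Proof.
move=> Dy; apply: le_limn_einf => e e0.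
have [gy|gy] := leP (g y) 0.
  have -> : g y = 0 by apply/eqP; rewrite eq_le gy g0.
  by near=> n; rewrite !mul0r sub0r oppr_le0 ltW.
(* A level within [e'] of [g y] costs at most [e / 2] after multiplication by
   [g y], and the error term of the mean costs the other half. *)
pose e' := Num.min (g y) (e / (2 * g y)).
have e'0 : 0 < e' by rewrite lt_min gy divr_gt0// mulr_gt0.
have t0 : 0 <= g y - e' by rewrite subr_ge0 ge_min lexx.
have tg : g y - e' < g y by rewrite gtrBl.
have [C hC] := fejer_mean_lower Dy t0 tg.
have ee : e' * g y <= e / 2.
  apply: (@le_trans _ _ (e / (2 * g y) * g y)).
    by rewrite ler_wpM2r ?(ltW gy)// ge_min lexx orbT.
  by rewrite invfM mulrA mulfVK ?gt_eqF.
have cv : (fun n => g y * C * (n.+1%:R)^-1) @ \oo --> (0 : R).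
  rewrite -[X in _ --> X](mulr0 (g y * C)); apply: cvgMr; exact: cvg_harmonic.
have e2 : 0 < e / 2 by rewrite divr_gt0.
near=> n.
have h : g y * C * (n.+1%:R)^-1 < e / 2.
  apply: le_lt_trans (ler_norm _) _; rewrite -[X in `|X|]subr0 distrC.
  by near: n; move/cvgrPdist_lt : cv; exact.
have := ler_wpM2l (ltW gy) (hC n.+1 isT); apply: le_trans.
have -> : g y * (g y - e' - C / n.+1%:R) =
    g y * g y - e' * g y - g y * C / n.+1%:R by ring.
by move: (e' * g y) (g y * C / _) (g y * g y) ee h => p q r; lra.
Unshelve. all: by end_near. Qed.

(** By Fatou's lemma the integral of [g^2] is at most the sum of the squared
    coefficients; Bessel's inequality is the converse. *)
Lemma is_fourier_inv_lsc : is_fourier v (fun x => (g x)%:C).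
Proof.
pose G := fun x => (g x)%:C.
have fourier_errE N : fourier_err v G N = rip G G - psumsq v N by exact: bessel_identity.
have bessel N : psumsq v N <= rip G G by rewrite -subr_ge0 -fourier_errE fourier_err_ge0.
have cv : cvgn (psumsq v).
  apply: nondecreasing_is_cvgn; first exact: psumsq_homo.
  by exists (rip G G) => _ [N _ <-].
have vl N : psumsq v N <= limn (psumsq v).
  by apply: nondecreasing_cvgn_le => //; exact: psumsq_homo.
have GG : rip G G = I (fun x => g x * g x).
  by apply: eq_I => x _; rewrite /rdot /= mulr0 addr0.
have le : rip G G <= limn (psumsq v).
  rewrite -lee_fin GG; apply: (@le_trans _ _ (\int[mu]_(x in D) (g x * g x)%:E)%E).
    by rewrite fineK//; apply: integrable_fin_num => //; exact: jgg.
  apply: (@le_trans _ _ (\int[mu]_(y in D)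
      limn_einf (fun n => (g y * fejer_mean n.+1 y)%:E))%E).
    apply: ge0_le_integral => //.
    - by move=> x _; rewrite lee_fin mulr_ge0.
    - by apply/measurable_EFinP; exact: measurable_funM.
    - apply: measurable_limn_einf => n; apply/measurable_EFinP.
      by apply: L1_measurable; exact: L1_g_fejer_mean.
    - by move=> x Dx; exact: sq_le_limn_einf.
  apply: le_trans (fatou _ _ _ _) _ => //.
  - by move=> n; apply/measurable_EFinP; apply: L1_measurable; exact: L1_g_fejer_mean.
  - by move=> n x _; rewrite lee_fin mulr_ge0 ?fejer_mean_ge0.
  apply: limn_einf_le => n.
  rewrite -[leLHS]fineK; last by apply: integrable_fin_num => //; exact: L1_g_fejer_mean.
  by rewrite lee_fin; apply: le_trans (vl n.+1); exact: I_g_fejer_mean_le.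
apply/is_fourierP; split=> //.
apply: (@squeeze_cvgr _ _ _ _ (fun=> 0) (fun N => limn (psumsq v) - psumsq v N)).
- by near=> M; rewrite fourier_err_ge0 /= fourier_errE lerD2r.
- exact: cvg_cst.
- by rewrite -[X in _ --> X](subrr (limn (psumsq v))); apply: cvgB => //; exact: cvg_cst.
Unshelve. all: by end_near. Qed.

End FejerMeans.

(** * Layer-cake formula *)

Section LayerCake.
Context {R : realType}.
Implicit Types (W a b : R -> R) (x s : R).
Notation mu := (@lebesgue_measure R).
Notation T := (measurableTypeR R).
Local Open Scope ereal_scope.

Lemma measurable_superlevel a s : measurable_fun [set: R] a ->
  measurable [set x | (s < a x)%R].
Proof.
move=> ma.
have : measurable_fun setT (fun x => s < a x)%R by exact: measurable_fun_ltr.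
by move=> /(_ measurableT [set true]); rewrite setTI; apply.
Qed.

Lemma measurable_layer W a : measurable_fun [set: R] W -> measurable_fun [set: R] a ->
  measurable_fun setT (fun p : T * T => (W p.1 * \1_(`[0%R, a p.1[%classic) p.2)%:E).
Proof.
move=> mW ma; apply/measurable_EFinP; apply: measurable_funM.
  by apply: measurableT_comp.
pose f1 (p : T * T) := (0 <= p.2)%R.
pose f2 (p : T * T) := (p.2 < a p.1)%R.
have -> : (fun p : T * T => \1_(`[0%R, a p.1[%classic) p.2 : R) =
    \1_(f1 @^-1` [set true] `&` f2 @^-1` [set true]).
  apply/funext => p; rewrite !indicE; congr (_%:R : R); congr (nat_of_bool _).
  by apply/idP/idP; rewrite !inE /= in_itv /= /f1 /f2 => /andP.
apply: measurable_indic; apply: measurableI.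
- have : measurable_fun setT f1 by exact: measurable_fun_ler.
  by move=> /(_ measurableT [set true]); rewrite setTI; apply.
- have : measurable_fun setT f2.
    by apply: measurable_fun_ltr => //; exact: measurableT_comp.
  by move=> /(_ measurableT [set true]); rewrite setTI; apply.
Qed.

Lemma layer_sectionE W a s : (0 <= s)%R ->
  measurable_fun [set: R] W -> measurable_fun [set: R] a -> (forall x, 0 <= W x)%R ->
  \int[mu]_x (W x * \1_(`[0%R, a x[%classic) s)%:E =
  \int[mu]_(x in [set x | (s < a x)%R]) (W x)%:E.
Proof.
move=> s0 mW ma W0; rewrite [RHS]integral_mkcond; apply: eq_mu => x _.
rewrite patchE indicE; have [sa|sa] := ltP s (a x).
  by rewrite [in RHS]mem_set// mem_set ?mulr1//= in_itv /= s0 sa.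
rewrite [in RHS]memNset//=; last by rewrite ltNge sa.
by rewrite memNset ?mulr0//= in_itv /= s0 ltNge sa.
Qed.

Lemma integral_indic_0co (c : R) : (0 <= c)%R ->
  \int[mu]_s (\1_(`[0%R, c[%classic) s)%:E = c%:E.
Proof.
move=> c0; transitivity (mu `[0%R, c[).
  by rewrite integral_indic// setIT.
rewrite lebesgue_measure_itv/= lte_fin; have [_|c1] := ltP; first by rewrite oppr0 adde0.
by congr _%:E; apply/eqP; rewrite eq_le c0 c1.
Qed.

(** [a x] is the length of the interval of the levels [s] with [0 <= s < a x];
    exchange the integrations over [x] and [s]. *)
Lemma layer_cake W a : measurable_fun [set: R] W -> measurable_fun [set: R] a ->
  (forall x, 0 <= W x)%R -> (forall x, 0 <= a x)%R ->
  \int[mu]_x (W x * a x)%:E =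
  \int[mu]_(s in `[0%R, +oo[) \int[mu]_(x in [set x | (s < a x)%R]) (W x)%:E.
Proof.
move=> mW ma W0 a0.
transitivity (\int[mu]_x \int[mu]_s (W x * \1_(`[0%R, a x[%classic) s)%:E).
  apply: eq_mu => x _; under eq_integral do rewrite EFinM.
  rewrite ge0_integralZl//; last 2 first.
  - by apply/measurable_EFinP; exact: measurable_indic.
  - by rewrite lee_fin.
  by rewrite integral_indic_0co// EFinM.
have := @fubini_tonelli _ _ T T R mu mu
  (fun p : T * T => (W p.1 * \1_(`[0%R, a p.1[%classic) p.2)%:E).
move=> -> /=; last 2 first.
- exact: measurable_layer.
- by move=> p; rewrite lee_fin mulr_ge0.
rewrite [RHS]integral_mkcond; apply: eq_mu => s _; rewrite patchE.
have [s0|s0] := leP 0%R s.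
  by rewrite mem_set/= ?in_itv/= ?s0//; exact: layer_sectionE.
rewrite memNset/= ?in_itv/= ?leNgt ?s0//.
by apply: integral0_eq => x _; rewrite indicE memNset ?mulr0//= in_itv /= leNgt s0.
Qed.

Lemma measurable_layers W a : measurable_fun [set: R] W -> measurable_fun [set: R] a ->
  (forall x, 0 <= W x)%R ->
  measurable_fun (`[0%R, +oo[%classic : set R)
    (fun s => \int[mu]_(x in [set x | (s < a x)%R]) (W x)%:E).
Proof.
move=> mW ma W0.
have := @measurable_fun_fubini_tonelli_G _ _ T T R mu
  (fun p : T * T => (W p.1 * \1_(`[0%R, a p.1[%classic) p.2)%:E).
move=> /(_ (measurable_layer mW ma)) mG.
have {}mG := mG _; apply: (eq_measurable_fun (fubini_G mu
  (fun p : T * T => (W p.1 * \1_(`[0%R, a p.1[%classic) p.2)%:E))).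
  move=> s; rewrite inE /= in_itv /= andbT => s0; rewrite /fubini_G /=.
  exact: layer_sectionE.
apply: measurable_funTS; apply: mG => p.
by rewrite lee_fin mulr_ge0.
Qed.

End LayerCake.

(** * Bathtub principle for the weights *)

Section Bathtub.
Context {R : realType}.
Implicit Types (A B : set R) (x s r : R) (m : nat).
Notation mu := (@lebesgue_measure R).
Notation D := (@freq_itv R).
Local Open Scope ereal_scope.

(** Even exponents come from the iterated Laplacian and odd ones from its
    difference. *)
Definition weight m x : R := (lapsym x ^+ m)%R.

Lemma weight_ge0 m x : (0 <= weight m x)%R.
Proof. by rewrite exprn_ge0// lapsym_ge0. Qed.

Lemma weight_le m x : (weight m x <= 4 ^+ m)%R.
Proof. by rewrite lerXn2r ?nnegrE ?lapsym_ge0 ?lapsym_le4. Qed.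

Lemma measurable_lapsym : measurable_fun [set: R] (@lapsym R).
Proof.
apply: continuous_measurable_fun => x.
by apply: cvgB; [exact: cvg_cst|apply: cvgMr; exact: continuous_cos].
Qed.

Lemma measurable_weight m : measurable_fun [set: R] (weight m).
Proof. by apply: measurable_funX; exact: measurable_lapsym. Qed.

Lemma freq_abs x : D x -> (`|x| < pi)%R.
Proof. by rewrite /freq_itv /= in_itv /= ltr_norml. Qed.

Lemma lapsym_abs x : lapsym `|x|%R = lapsym x :> R.
Proof. by rewrite /lapsym cos_norm. Qed.

Lemma lapsym_mono r x : (0 <= r)%R -> (r < `|x|)%R -> D x -> (lapsym r < lapsym x)%R.
Proof.
move=> r0 rx /freq_abs xpi; rewrite -(lapsym_abs x) /lapsym ltrD2l ltrN2 ltr_pM2l//.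
rewrite ltr_cos// in_itv /= ?normr_ge0 ?r0 /= ltW//.
exact: lt_trans xpi.
Qed.

Lemma weight_mono m r x : (0 <= r)%R -> (r <= `|x|)%R -> D x -> (weight m r <= weight m x)%R.
Proof.
move=> r0; rewrite le_eqVlt => /predU1P[->|rx] Dx; first by rewrite /weight lapsym_abs.
by rewrite /weight lerXn2r ?nnegrE ?lapsym_ge0// ltW// lapsym_mono.
Qed.

Lemma weight_lt m r x : (0 < m)%N -> (0 <= r)%R -> (r < `|x|)%R -> D x ->
  (weight m r < weight m x)%R.
Proof.
by move=> m0 r0 rx Dx; rewrite /weight ltrXn2r -?lt0n ?lapsym_ge0// lapsym_mono.
Qed.

Lemma measure_sub_freq A : measurable A -> A `<=` D -> mu A < +oo.
Proof.
move=> mA AD; apply: (@le_lt_trans _ _ (mu D)).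
  by apply: le_measure; rewrite ?inE//; exact: measurable_freq.
by rewrite measure_freq ltry.
Qed.

Lemma measurable_weightE m A : measurable_fun A (fun x => (weight m x)%:E).
Proof. by apply/measurable_EFinP; apply: measurable_funTS; exact: measurable_weight. Qed.

Lemma integral_weight_fin m A : measurable A -> A `<=` D ->
  \int[mu]_(x in A) (weight m x)%:E \is a fin_num.
Proof.
move=> mA AD; rewrite ge0_fin_numE; last first.
  by apply: integral_ge0 => x _; rewrite lee_fin weight_ge0.
apply: (@le_lt_trans _ _ (\int[mu]_(x in A) (4 ^+ m)%:E)).
  apply: ge0_le_integral => //.
  - by move=> x _; rewrite lee_fin weight_ge0.
  - exact: measurable_weightE.
  - by move=> x _; rewrite lee_fin weight_le.
rewrite integral_cst// lte_mul_pinfty ?lee_fin ?exprn_ge0//.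
exact: measure_sub_freq.
Qed.

Lemma integral_weight_split m A B : measurable A -> measurable B ->
  \int[mu]_(x in A) (weight m x)%:E =
  \int[mu]_(x in A `&` B) (weight m x)%:E + \int[mu]_(x in A `\` B) (weight m x)%:E.
Proof.
move=> mA mB; rewrite -[in LHS](setUIDK A B) ge0_integral_setU//.
- exact: measurableI.
- exact: measurableD.
- exact: measurable_weightE.
- by move=> x _; rewrite lee_fin weight_ge0.
- apply/disj_setPS => x [[_ Bx] [_]]; exact.
Qed.

Lemma measure_setD_eq A B : measurable A -> measurable B -> A `<=` D -> B `<=` D ->
  mu A = mu B -> mu (A `\` B) = mu (B `\` A).
Proof.
move=> mA mB AD BD AB.
have muD E F : measurable E -> measurable F -> E `<=` D ->
    mu (E `\` F) = mu E - mu (E `&` F).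
  by move=> mE mF ED; apply: measureD => //; exact: measure_sub_freq.
by rewrite !muD// AB setIC.
Qed.

Lemma ae_imp (P Q : R -> Prop) : {ae mu, forall x, P x} ->
  (forall x, P x -> Q x) -> {ae mu, forall x, Q x}.
Proof.
move=> aeP PQ; apply: negligibleS aeP => x /= nQ Px.
by apply: nQ; exact: PQ.
Qed.

(** The nonnegative function [f - g] has integral 0. *)
Lemma ae_eq_integral_le (E : set R) (f g : R -> \bar R) : measurable E ->
  measurable_fun E f -> measurable_fun E g ->
  (forall x, E x -> f x \is a fin_num) -> (forall x, 0 <= g x) ->
  (forall x, E x -> g x <= f x) -> \int[mu]_(x in E) f x < +oo ->
  \int[mu]_(x in E) f x = \int[mu]_(x in E) g x ->
  {ae mu, forall x, E x -> f x = g x}.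
Proof.
move=> mE mf mg ffin g0 gf foo fg.
have f0 x : E x -> 0 <= f x by move=> Ex; apply: le_trans (gf x Ex).
have jf : mu.-integrable E f.
  apply/integrableP; split=> //.
  by rewrite (eq_mu (G := f)) => // x Ex; rewrite gee0_abs// f0.
have jg : mu.-integrable E g.
  apply/integrableP; split=> //.
  by rewrite (eq_mu (G := g)) -?fg// => x Ex; rewrite gee0_abs.
have diff0 : \int[mu]_(x in E) `|f x - g x| = 0.
  transitivity (\int[mu]_(x in E) (f x - g x)).
    apply: eq_mu => x Ex; rewrite gee0_abs// sube_ge0 ?gf//.
    by rewrite ffin ?orbT.
  by rewrite integralB// -fg subee//; apply: integrable_fin_num.
have mfg : measurable_fun E (fun x => f x - g x) by exact: emeasurable_funB.
have /(ae_eq_integral_abs mu mE mfg) := diff0.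
move/ae_imp; apply => x h Ex; have fE := ffin x Ex.
have gE : g x \is a fin_num.
  rewrite ge0_fin_numE//; apply: le_lt_trans (gf x Ex) _.
  by rewrite -ge0_fin_numE// f0.
by rewrite -[LHS](subeK _ gE) h// add0e.
Qed.

Section compare.
Context (m : nat) (A B : set R) (r : R).
Context (mA : measurable A) (mB : measurable B) (AD : A `<=` D) (BD : B `<=` D).
Context (AB : mu A = mu B) (r0 : (0 <= r)%R) (rpi : (r <= pi)%R).
Context (Br : forall x, B x -> (`|x| < r)%R).
Context (Ar : forall x, A x -> ~ B x -> (r <= `|x|)%R).

Let mAB : measurable (A `\` B). Proof. exact: measurableD. Qed.
Let mBA : measurable (B `\` A). Proof. exact: measurableD. Qed.

Let lowAB : (weight m r)%:E * mu (A `\` B) <= \int[mu]_(x in A `\` B) (weight m x)%:E.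
Proof.
rewrite -integral_cst//; apply: ge0_le_integral => //.
- by move=> x _; rewrite lee_fin weight_ge0.
- exact: measurable_weightE.
- by move=> x [Ax Bx]; rewrite lee_fin weight_mono//; [exact: Ar|exact: AD].
Qed.

Let upBA : \int[mu]_(x in B `\` A) (weight m x)%:E <= (weight m r)%:E * mu (B `\` A).
Proof.
rewrite -integral_cst//; apply: ge0_le_integral => //.
- by move=> x _; rewrite lee_fin weight_ge0.
- exact: measurable_weightE.
- move=> x [Bx _]; rewrite lee_fin /weight lerXn2r ?nnegrE ?lapsym_ge0//.
  rewrite -(lapsym_abs x) /lapsym lerD2l lerN2 ler_pM2l//.
  rewrite leNgt ltr_cos ?in_itv /= ?r0 ?rpi ?normr_ge0//.
    by rewrite -leNgt ltW// Br.
  by apply: ltW; apply: freq_abs; exact: BD.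
Qed.

(** The parts of [A] and [B] outside each other have the same measure; on the
    former the weight is at least its value at radius [r], on the latter at
    most. *)
Lemma bathtub_le : \int[mu]_(x in B) (weight m x)%:E <= \int[mu]_(x in A) (weight m x)%:E.
Proof.
rewrite (integral_weight_split m mA mB) (integral_weight_split m mB mA) setIC leeD2l//.
by apply: (le_trans upBA); rewrite -(measure_setD_eq mA mB).
Qed.

(** Equality forces the weight to equal its value at radius [r] almost
    everywhere on the part of [A] outside [B].  When the weight is strictly
    increasing this leaves only the points [r] and [- r]. *)
Lemma bathtub_eq : (0 < m)%N ->
  \int[mu]_(x in A) (weight m x)%:E = \int[mu]_(x in B) (weight m x)%:E ->
  mu (A `\` B) = 0 /\ mu (B `\` A) = 0.
Proof.
move=> m0; rewrite (integral_weight_split m mA mB) (integral_weight_split m mB mA) setIC => e.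
suff AB0 : mu (A `\` B) = 0 by rewrite -(measure_setD_eq mA mB).
have fI : \int[mu]_(x in B `&` A) (weight m x)%:E \is a fin_num.
  by apply: integral_weight_fin; [exact: measurableI|move=> x [/BD]].
have {}e : \int[mu]_(x in A `\` B) (weight m x)%:E = \int[mu]_(x in B `\` A) (weight m x)%:E.
  by rewrite -[LHS](addeK _ fI) [X in X - _]addeC e [X in X - _]addeC addeK.
have e2 : \int[mu]_(x in A `\` B) (weight m x)%:E = (weight m r)%:E * mu (A `\` B).
  apply/eqP; rewrite eq_le lowAB andbT e.
  by apply: le_trans upBA _; rewrite -(measure_setD_eq mA mB).
have AB_D : A `\` B `<=` D by move=> x [/AD].
have iW : mu.-integrable (A `\` B) (EFin \o weight m).
  apply/integrableP; split; first exact: measurable_weightE.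
  under eq_integral do rewrite gee0_abs ?lee_fin ?weight_ge0//.
  by rewrite -ge0_fin_numE ?integral_weight_fin// integral_ge0// => x _; rewrite lee_fin weight_ge0.
have ic : mu.-integrable (A `\` B) (EFin \o cst (weight m r)).
  apply/integrableP; split; first exact/measurable_EFinP.
  under eq_integral do rewrite /= ger0_norm ?weight_ge0//.
  rewrite integral_cst// lte_mul_pinfty ?lee_fin ?weight_ge0//.
  exact: measure_sub_freq.
have diff0 : \int[mu]_(x in A `\` B) `|(weight m x - weight m r)%:E| = 0.
  transitivity (\int[mu]_(x in A `\` B) ((weight m x)%:E - (weight m r)%:E)).
    apply: eq_mu => x [Ax Bx]; rewrite gee0_abs// lee_fin subr_ge0.
    by apply: weight_mono => //; [exact: Ar|exact: AD].
  rewrite integralB_EFin// e2 integral_cst// subee// fin_numM//.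
  by rewrite ge0_fin_numE ?measure_ge0// measure_sub_freq.
have aeW : {ae mu, forall x, (A `\` B) x -> (weight m x - weight m r)%:E = 0}.
  apply/(ae_eq_integral_abs mu mAB) => //.
  apply/measurable_EFinP; apply: measurable_funB => //.
  by apply: measurable_funTS; exact: measurable_weight.
apply: measure_negligible => //.
have n1 c : mu.-negligible [set c].
  by apply/negligibleP => //; exact: lebesgue_measure_set1.
apply: negligibleS (negligibleU aeW (negligibleU (n1 r) (n1 (- r)%R))) => x ABx.
have [xr|xr] := eqVneq `|x|%R r.
  right; have [x0|x0] := leP 0%R x; [left|right] => /=; rewrite -xr.
    by rewrite ger0_norm.
  by rewrite ltr0_norm ?opprK.
left => /= /(_ ABx) [/eqP]; rewrite subr_eq0 => /eqP wE.
have [Ax Bx] := ABx.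
have : (weight m r < weight m x)%R.
  by apply: weight_lt => //; [rewrite lt_neqAle eq_sym xr Ar|exact: AD].
by rewrite wE ltxx.
Qed.

End compare.

Section comparison.
Context (m : nat) (a b : R -> R) (r : R -> R).
Context (ma : measurable_fun [set: R] a) (mb : measurable_fun [set: R] b).
Context (a0 : forall x, (0 <= a x)%R) (b0 : forall x, (0 <= b x)%R).
Context (aD : forall x, ~ D x -> a x = 0%R) (bD : forall x, ~ D x -> b x = 0%R).
Context (abE : forall s, (0 <= s)%R ->
  mu [set x | (s < a x)%R] = mu [set x | (s < b x)%R]).
Context (r0 : forall s, (0 <= r s)%R) (rpi : forall s, (r s <= pi)%R).
Context (br : forall s x, (0 <= s)%R -> (s < b x)%R -> (`|x| < r s)%R).
Context (ar : forall s x, (0 <= s)%R -> (s < a x)%R -> ~ (s < b x)%R ->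
  (r s <= `|x|)%R).

Let sup_sub (c : R -> R) s : (forall x, ~ D x -> c x = 0%R) -> (0 <= s)%R ->
  [set x | (s < c x)%R] `<=` D.
Proof.
move=> cD s0 x /= sc; apply: contrapT => Dx; move: sc.
by rewrite cD// ltNge s0.
Qed.

Let layer (c : R -> R) s : \bar R := \int[mu]_(x in [set x | (s < c x)%R]) (weight m x)%:E.

Let layer_le s : (0 <= s)%R -> layer b s <= layer a s.
Proof.
move=> s0; apply: (@bathtub_le m _ _ (r s)) => //.
- exact: measurable_superlevel.
- exact: measurable_superlevel.
- exact: sup_sub.
- exact: sup_sub.
- exact: abE.
- by move=> x; exact: br.
- by move=> x; exact: ar.
Qed.

Let pos_itv (s : R) : (`[0%R, +oo[%classic : set R) s -> (0 <= s)%R.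
Proof. by rewrite /= in_itv /= andbT. Qed.

Let layer_ge0 c s : 0 <= layer c s.
Proof. by apply: integral_ge0 => x _; rewrite lee_fin weight_ge0. Qed.

Let mlayer (c : R -> R) : measurable_fun [set: R] c ->
  measurable_fun (`[0%R, +oo[%classic : set R) (layer c).
Proof.
move=> mc; apply: measurable_layers => //; first exact: measurable_weight.
exact: weight_ge0.
Qed.

Let cake (c : R -> R) : measurable_fun [set: R] c -> (forall x, (0 <= c x)%R) ->
  \int[mu]_x (weight m x * c x)%:E = \int[mu]_(s in `[0%R, +oo[) layer c s.
Proof.
move=> mc c0; apply: layer_cake => //; first exact: measurable_weight.
exact: weight_ge0.
Qed.

Lemma comparison_le :
  \int[mu]_x (weight m x * b x)%:E <= \int[mu]_x (weight m x * a x)%:E.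
Proof.
rewrite !cake//; apply: ge0_le_integral => //.
- exact: mlayer.
- exact: mlayer.
- by move=> s /pos_itv; exact: layer_le.
Qed.

Let layer_fin (c : R -> R) s :
  measurable_fun [set: R] c -> (forall x, ~ D x -> c x = 0%R) -> (0 <= s)%R -> layer c s \is a fin_num.
Proof.
move=> mc cD s0; apply: integral_weight_fin; first exact: measurable_superlevel.
exact: sup_sub.
Qed.

Let good s := mu.-negligible [set x | (s < a x)%R <> (s < b x)%R].

Let ae_good : (0 < m)%N -> \int[mu]_x (weight m x * a x)%:E < +oo ->
  \int[mu]_x (weight m x * a x)%:E = \int[mu]_x (weight m x * b x)%:E ->
  {ae mu, forall s, (0 <= s)%R -> good s}.
Proof.
move=> m0; rewrite !cake// => afin ab.
have aeL : {ae mu, forall s, (`[0%R, +oo[%classic : set R) s -> layer a s = layer b s}.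
  apply: ae_eq_integral_le ab => //.
  - exact: mlayer.
  - exact: mlayer.
  - by move=> s /pos_itv s0; exact: layer_fin.
  - by move=> s /pos_itv; exact: layer_le.
apply: (ae_imp aeL) => s + s0; have ps : (`[0%R, +oo[%classic : set R) s.
  by rewrite /= in_itv /= s0.
move=> /(_ ps) lE.
have mA := measurable_superlevel s ma; have mB := measurable_superlevel s mb.
have [h1 h2] : mu ([set x | (s < a x)%R] `\` [set x | (s < b x)%R]) = 0 /\
               mu ([set x | (s < b x)%R] `\` [set x | (s < a x)%R]) = 0.
  exact: (bathtub_eq mA mB (sup_sub aD s0) (sup_sub bD s0) (abE s0) (r0 s) (rpi s)
    (fun x => br s0) (fun x => ar s0) m0 lE).
have ng E F : measurable E -> measurable F -> mu (E `\` F) = 0 ->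
    mu.-negligible (E `\` F).
  by move=> mE mF EF; apply/negligibleP => //; exact: measurableD.
have nU := negligibleU (ng _ _ mA mB h1) (ng _ _ mB mA h2).
rewrite /good; apply: negligibleS nU => x /= ne.
have [sa|sa] := boolP (s < a x)%R; have [sb|sb] := boolP (s < b x)%R.
- by case: ne; rewrite sa sb.
- by left; split=> //; exact/negP.
- by right; split=> //; exact/negP.
- by case: ne; rewrite (negbTE sa) (negbTE sb).
Qed.

(** For almost every level the superlevel sets of [a] and [b] agree up to a null
    set.  One such level is selected between any two rationals; off the union of
    the countably many null sets, a level strictly between [a x] and [b x]
    cannot exist. *)
Lemma comparison_eq : (0 < m)%N -> \int[mu]_x (weight m x * a x)%:E < +oo ->
  \int[mu]_x (weight m x * a x)%:E = \int[mu]_x (weight m x * b x)%:E ->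
  {ae mu, forall x, a x = b x}.
Proof.
move=> m0 afin ab; have [N [mN N0 gN]] := ae_good m0 afin ab.
have /choice[sel selP] : forall pq : rat * rat, exists s : R,
    (0 <= ratr pq.1 :> R)%R -> (ratr pq.1 < ratr pq.2 :> R)%R ->
    [/\ (ratr pq.1 < s)%R, (s < ratr pq.2)%R & good s].
  move=> [p q] /=; have [p0|p0] := leP 0%R (ratr p : R); last by exists 0%R.
  have [pq|pq] := ltP (ratr p : R) (ratr q); last by exists 0%R.
  (* An interval contained in the null set [N] of bad levels would be null. *)
  suff [s [ps sq Ns]] : exists s, [/\ (ratr p < s)%R, (s < ratr q)%R & ~ N s].
    exists s => _ _; split=> //; apply: contrapT => gs; apply: Ns; apply: gN => /= h.
    by apply: gs; apply: h; apply: ltW; exact: le_lt_trans ps.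
  apply: contrapT => nex.
  have sub : `](ratr p : R), (ratr q)[%classic `<=` N.
    move=> s /=; rewrite in_itv /= => /andP[ps sq]; apply: contrapT => Ns.
    by apply: nex; exists s.
  have : mu `](ratr p : R), (ratr q)[%classic <= mu N.
    by apply: le_measure; rewrite ?inE.
  rewrite N0 lebesgue_measure_itv/= lte_fin pq -EFinB lee_fin subr_le0.
  by rewrite leNgt pq.
pose pr n : rat * rat := odflt (0%R, 0%R) (unpickle n).
have : {ae mu, forall x, forall n : nat, (0 <= ratr (pr n).1 :> R)%R ->
    (ratr (pr n).1 < ratr (pr n).2 :> R)%R -> (sel (pr n) < a x)%R = (sel (pr n) < b x)%R}.
  apply: ae_foralln => n.
  have [p0|p0] := leP 0%R (ratr (pr n).1 : R); last first.
    exact: aeW.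
  have [pq|pq] := ltP (ratr (pr n).1 : R) (ratr (pr n).2); last first.
    exact: aeW.
  have [_ _ gs] := selP _ p0 pq; apply: negligibleS gs => x /= h e.
  by apply: h => _ _; exact: e.
move/ae_imp; apply => x h.
have sep (c d : R -> R) : (forall x, (0 <= c x)%R) ->
    (forall n : nat, (0 <= ratr (pr n).1 :> R)%R ->
    (ratr (pr n).1 < ratr (pr n).2 :> R)%R -> (sel (pr n) < c x)%R = (sel (pr n) < d x)%R) ->
    (d x <= c x)%R.
  move=> c0 {}h; rewrite leNgt; apply/negP => cd.
  have [q' /[!in_itv]/= /andP[cq qd]] := rat_in_itvoo cd.
  have [p' /[!in_itv]/= /andP[cp pq]] := rat_in_itvoo cq.
  have := h (pickle (p', q')); rewrite /pr pickleK /=.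
  have p0 : (0 <= ratr p' :> R)%R by apply: (le_trans (c0 x)); exact: ltW.
  have [ps sq _] := selP (p', q') p0 pq.
  move=> /(_ p0 pq); rewrite (lt_trans sq qd).
  by rewrite ltNge (ltW (lt_trans cp ps)).
apply/eqP; rewrite eq_le; apply/andP; split; apply: sep => //.
by move=> n h1 h2; rewrite h.
Qed.

End comparison.
End Bathtub.

(** * The symmetric decreasing rearrangement *)

Section Rearrangement.
Context {R : realType}.
Implicit Types (x s t : R).
Local Open Scope complex_scope.
Notation mu := (@lebesgue_measure R).
Notation D := (@freq_itv R).
Notation I h := (\int[mu]_(x in D) h x).

(** Applied to the levels [t] at which the rearranged superlevel set contains a
    given point: they form a half-open interval starting at 0, whose length is
    the value of the rearrangement. *)
Lemma down_set (P : R -> Prop) :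
  (forall t t', 0 <= t' -> t' <= t -> P t -> P t') ->
  (forall t, 0 <= t -> P t -> exists2 t', t < t' & P t') ->
  (forall t, 0 <= t -> P t) \/
  exists2 s, 0 <= s & forall t, 0 <= t -> P t <-> t < s.
Proof.
move=> dP oP; have [allP|] := pselect (forall t, 0 <= t -> P t); first by left.
move=> /existsNP[t0] /not_implyP[t00 nPt0]; right.
pose S := [set t | 0 <= t /\ P t].
have ubS : ubound S t0.
  move=> t [t1 Pt]; rewrite leNgt; apply/negP => tt; apply: nPt0.
  by apply: dP Pt => //; exact: ltW.
have [S0|/set0P[t1 [t10 Pt1]]] := eqVneq S set0.
  exists 0 => // t t1; split=> [Pt|]; last by rewrite ltNge t1.
  by have : S t by []; rewrite S0.
have hS : has_sup S by split; [exists t1|exists t0].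
exists (sup S) => [|t tge0].
  by apply: (le_trans t10); apply: ub_le_sup; [exists t0|].
split=> [Pt|tS].
  have [t' tt' Pt'] := oP _ tge0 Pt; apply: (lt_le_trans tt').
  by apply: ub_le_sup; [exists t0|split=> //; apply: le_trans (ltW tt')].
have [t' [t'0 Pt'] tt'] := sup_gt (ex_intro _ t1 (conj t10 Pt1)) tS.
by apply: dP Pt' => //; exact: ltW.
Qed.

Context (f : R -> R[i]) (Lf : L2 f).

Let q x : R := rdot (f x) (f x).
Let mq : measurable_fun D q. Proof. by have [mf _] := Lf; exact: measurable_rdot. Qed.

Lemma superlevelE t : 0 <= t -> superlevel f t = D `&` [set x | t ^+ 2 < q x].
Proof.
move=> t0; rewrite /superlevel; congr (_ `&` _); apply: eq_set => x.
by rewrite /q -normc_sqE ltr_pXn2r// nnegrE normc_ge0.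
Qed.

Lemma measurable_superlevel_freq t : 0 <= t -> measurable (superlevel f t).
Proof.
move=> t0; rewrite superlevelE//.
have : measurable_fun D (fun x => t ^+ 2 < q x)%R by exact: measurable_fun_ltr.
by move=> /(_ measurable_freq [set true]); apply.
Qed.

Lemma superlevel_sub t : superlevel f t `<=` D.
Proof. by move=> x []. Qed.

Definition distr_fun t : R := fine (mu (superlevel f t)).

Lemma distr_funE t : 0 <= t -> mu (superlevel f t) = (distr_fun t)%:E.
Proof.
move=> t0; rewrite /distr_fun fineK// ge0_fin_numE ?measure_ge0//.
apply: measure_sub_freq; [exact: measurable_superlevel_freq|exact: superlevel_sub].
Qed.

Lemma distr_fun_ge0 t : 0 <= distr_fun t.
Proof. by rewrite fine_ge0. Qed.

Lemma distr_fun_le2pi t : 0 <= t -> distr_fun t <= 2 * pi.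
Proof.
move=> t0; rewrite -lee_fin -distr_funE// -measure_freq; apply: le_measure; rewrite ?inE.
- exact: measurable_superlevel_freq.
- exact: measurable_freq.
- exact: superlevel_sub.
Qed.

Lemma distr_fun_mono t t' : 0 <= t' -> t' <= t -> distr_fun t <= distr_fun t'.
Proof.
move=> t0 tt; have t1 := le_trans t0 tt.
rewrite -lee_fin -!distr_funE//; apply: le_measure; rewrite ?inE;
  try exact: measurable_superlevel_freq.
by move=> x [Dx h]; split=> //; exact: le_lt_trans h.
Qed.

(** The superlevel set at [t] is the increasing union of those at [t + 1/n], so
    the distribution function is right continuous. *)
Lemma distr_fun_right t (c : R) : 0 <= t -> c < distr_fun t -> exists2 t', t < t' & c < distr_fun t'.
Proof.
move=> t0 ct; pose F n := superlevel f (t + n.+1%:R^-1).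
have F0 n : 0 <= t + n.+1%:R^-1 by rewrite addr_ge0// invr_ge0.
have FU : \bigcup_n F n = superlevel f t.
  apply/seteqP; split=> [x [n _ [Dx h]]|x [Dx h]].
    by split=> //; apply: le_lt_trans h; rewrite lerDl invr_ge0.
  have [n nh] : exists n, n.+1%:R^-1 < Normc.normc (f x) - t.
    have := @cvg_harmonic R; move/cvgrPdist_lt => /(_ (Normc.normc (f x) - t)).
    rewrite subr_gt0 => /(_ h)[N _ /(_ N (leqnn N))] /=.
    by rewrite sub0r normrN ger0_norm ?invr_ge0// => ?; exists N.
  by exists n => //; split=> //=; rewrite -ltrBrDl.
have : mu (F n) @[n --> \oo] --> mu (\bigcup_n F n).
  apply: nondecreasing_cvg_mu.
  - by move=> n; exact: measurable_superlevel_freq.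
  - by rewrite FU; exact: measurable_superlevel_freq.
  - move=> n m nm; rewrite subsetEset => x [Dx h]; split=> //; apply: le_lt_trans h.
    by rewrite lerD2l lef_pV2 ?posrE ?ltr0n// ler_nat.
rewrite FU distr_funE// => Fc.
have {}Fc : distr_fun (t + n.+1%:R^-1) @[n --> \oo] --> distr_fun t.
  have /fine_cvgP[_] := Fc; exact.
have /cvgrPdist_lt /(_ (distr_fun t - c)) := Fc; rewrite subr_gt0 => /(_ ct)[N _ /(_ N (leqnn N))] /=.
move=> h; exists (t + N.+1%:R^-1); first by rewrite ltrDl invr_gt0.
by have := le_lt_trans (ler_norm _) h; rewrite ltrD2l ltrN2.
Qed.

(** Chebyshev's inequality; it is the reason why the rearrangement is finite
    away from 0. *)
Lemma distr_fun_small (c : R) : 0 < c -> exists2 t, 0 <= t & distr_fun t <= c.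
Proof.
move=> c0; pose P := rip f f.
have P0 : 0 <= P := rip_ge0 f.
have cheb t : 0 <= t -> t ^+ 2 * distr_fun t <= P.
  move=> t0; rewrite -lee_fin EFinM -distr_funE// -integral_rip//.
  have mA := measurable_superlevel_freq t0.
  rewrite -integral_cst//.
  apply: (@le_trans _ _ (\int[mu]_(x in superlevel f t) (q x)%:E)%E).
    apply: ge0_le_integral => //.
    - by move=> x _; rewrite lee_fin sqr_ge0.
    - apply/measurable_EFinP; apply: measurable_funS mq => //.
      exact: superlevel_sub.
    - by move=> x; rewrite superlevelE// => -[_ /= h]; rewrite lee_fin; exact: ltW.
  have -> : (\int[mu]_(x in D) (Normc.normc (f x) ^+ 2)%:E =
             \int[mu]_(x in D) (q x)%:E)%E.
    by apply: eq_mu => x _; rewrite normc_sqE.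
  apply: ge0_subset_integral => //.
  - exact/measurable_EFinP.
  - by move=> x _; rewrite lee_fin rdot_ge0.
  - exact: superlevel_sub.
pose t := Num.sqrt (P / c).
have t0 : 0 <= t by exact: sqrtr_ge0.
have [Pc|] := leP P 0.
  have := cheb 1 ler01; rewrite expr1n mul1r => h.
  by exists 1 => //; apply: (le_trans h); apply: (le_trans Pc); exact: ltW.
move=> Pc; exists t => //; have := cheb t t0.
by rewrite /t sqr_sqrtr ?divr_ge0 ?(ltW c0)// mulrAC ler_pdivrMr// ler_pM2l.
Qed.

Lemma set_rearrP t x : set_rearr (superlevel f t) x <-> `|x| < distr_fun t / 2.
Proof. by rewrite /set_rearr -/(distr_fun t) /= in_itv /= ltr_norml. Qed.

(** The value at [x] is the length of the set of levels [t] with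
    [|x| < distr_fun t / 2].  That set is bounded unless [x = 0], where [f] may
    be essentially unbounded. *)
Lemma rearr_spec x :
  (exists2 s, 0 <= s & rearr f x = s%:E /\
     forall t, 0 <= t -> (`|x| < distr_fun t / 2 <-> t < s)) \/
  (x = 0 /\ rearr f x = +oo%E).
Proof.
have m0y : measurable (`[0, +oo[%classic : set R) by exact: measurable_itv.
case: (@down_set (fun t => `|x| < distr_fun t / 2)).
- move=> t t' t0 tt h; apply: (lt_le_trans h).
  by rewrite ler_pM2r ?invr_gt0// distr_fun_mono.
- move=> t t0; rewrite ltr_pdivlMr// => /(distr_fun_right t0)[t' tt h].
  by exists t' => //; rewrite ltr_pdivlMr.
- move=> all; right; split.
    apply: contrapT => /eqP x0.
    have c0 : 0 < `|x| by rewrite normr_gt0.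
    have [t t0 lt] := distr_fun_small c0; have := all t t0.
    by apply/negP; rewrite -leNgt ler_pdivrMr// (le_trans lt)// ler_peMr ?normr_ge0// ler1n.
  rewrite /rearr (eq_mu (G := cst 1%E)).
    have m0y_oo : mu `[0, +oo[%classic = +oo%E by rewrite lebesgue_measure_itv/= ltry.
    by rewrite integral_cst// mul1e; exact: m0y_oo.
  move=> t /=; rewrite in_itv /= andbT => t0.
  by rewrite indicE mem_set//; apply/set_rearrP; exact: all.
- move=> [s s0 sP]; left; exists s => //; split=> //.
  rewrite /rearr (eq_mu (G := fun t => (\1_(`[0, s[%classic) t)%:E)).
    transitivity (mu `[0, s[%classic).
      rewrite integral_indic//= setIidl// => t /=.
      by rewrite !in_itv /= => /andP[->].
    rewrite lebesgue_measure_itv/= lte_fin; have [_|s1] := ltP; first by rewrite oppr0 adde0.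
    by congr _%:E; apply/eqP; rewrite eq_le s0 s1.
  move=> t /=; rewrite in_itv /= andbT => t0; congr _%:E.
  have [ts|ts] := ltP t s.
    by rewrite !indicE !mem_set//= ?in_itv /= ?t0//; apply/set_rearrP/sP.
  rewrite !indicE !memNset//= ?in_itv /= ?t0 ?ltNge ?ts//.
  by move/set_rearrP/(sP _ t0); rewrite ltNge ts.
Qed.

(** This is 0 at the origin when the rearrangement is infinite there. *)
Definition rearr_real x : R := fine (rearr f x).

Lemma rearr_real_ge0 x : 0 <= rearr_real x.
Proof.
rewrite /rearr_real; have [[s s0 [-> _]]|[_ ->]] := rearr_spec x; by [].
Qed.

Lemma rearr_fine x : x != 0 -> rearr f x = (rearr_real x)%:E.
Proof.
by rewrite /rearr_real; have [[s s0 [-> _]]|[-> _]] := rearr_spec x => //; rewrite eqxx.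
Qed.

Lemma rearr_realP x t : x != 0 -> 0 <= t -> (t < rearr_real x <-> `|x| < distr_fun t / 2).
Proof.
move=> x0 t0; rewrite /rearr_real.
have [[s s0 [-> sP]]|[xE _]] := rearr_spec x; last by rewrite xE eqxx in x0.
by rewrite sP.
Qed.

(** Away from the origin the superlevel sets are those of [rearr_realP], hence
    open; at the origin the value is either governed by the same intervals or
    equal to 0, and then no level lies below it. *)
Lemma rearr_real_lsc y t : 0 <= t -> t < rearr_real y ->
  exists2 d : R, 0 < d & forall x, `|x - y| < d -> t < rearr_real x.
Proof.
move=> t0 ty.
have [[s s0 [sE sP]]|[_ yoo]] := rearr_spec y; last first.
  by move: ty; rewrite /rearr_real yoo /= ltNge t0.
have yt : `|y| < distr_fun t / 2 by apply/sP => //; move: ty; rewrite /rearr_real sE.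
have close x : `|x - y| < distr_fun t / 2 - `|y| -> `|x| < distr_fun t / 2.
  rewrite ltrBrDr; apply: le_lt_trans.
  by rewrite -[X in `|X| <= _](subrK y) ler_normD.
have [y0|y0] := eqVneq y 0.
  exists (distr_fun t / 2 - `|y|); first by rewrite subr_gt0.
  move=> x /close xt; have [x0|x0] := eqVneq x 0; last exact/rearr_realP.
  by rewrite x0 -y0.
(* The first bound keeps [x] away from the origin. *)
exists (Num.min `|y| (distr_fun t / 2 - `|y|)).
  by rewrite lt_min normr_gt0 y0 subr_gt0.
move=> x; rewrite lt_min => /andP[xy /close xt]; apply/rearr_realP => //.
by apply: contraTneq xy => ->; rewrite sub0r normrN ltxx.
Qed.

Lemma measurable_rearr_real : measurable_fun [set: R] rearr_real.
Proof.
apply/measurable_EFinP; apply: lower_semicontinuous_measurable => y t.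
rewrite /= lte_fin => ty; have [t0|t0] := leP 0 t.
  have [d d0 h] := rearr_real_lsc t0 ty.
  exists (ball y d); first exact: nbhsx_ballx.
  by move=> x; rewrite /ball /= lte_fin distrC => /h.
exists setT; first exact: filterT.
by move=> x _; rewrite lte_fin (lt_le_trans t0)// rearr_real_ge0.
Qed.

Let D0 : set R := D `\` [set 0].

Let mD0 : measurable D0. Proof. exact: measurableD. Qed.

Let a : R -> R := q \_ D0.
Let b : R -> R := (fun x => rearr_real x ^+ 2) \_ D0.

Let aE x : D x -> x != 0 -> a x = q x.
Proof. by move=> Dx /eqP x0; rewrite /a patchE mem_set. Qed.

Let bE x : D x -> x != 0 -> b x = rearr_real x ^+ 2.
Proof. by move=> Dx /eqP x0; rewrite /b patchE mem_set. Qed.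

Let a_out x : ~ D0 x -> a x = 0.
Proof. by move=> Dx; rewrite /a patchE memNset. Qed.

Let b_out x : ~ D0 x -> b x = 0.
Proof. by move=> Dx; rewrite /b patchE memNset. Qed.

Let ma : measurable_fun [set: R] a.
Proof.
apply/(measurable_restrictT _ _).1 => //.
by apply: measurable_funS mq => //; exact: subDsetl.
Qed.

Let mb : measurable_fun [set: R] b.
Proof.
apply/(measurable_restrictT _ _).1 => //.
by apply: measurable_funTS; apply: measurable_funX; exact: measurable_rearr_real.
Qed.

Let a0 x : 0 <= a x.
Proof. by rewrite /a patchE; case: ifP => // _; exact: rdot_ge0. Qed.

Let b0 x : 0 <= b x.
Proof. by rewrite /b patchE; case: ifP => // _; exact: sqr_ge0. Qed.

Let rad s : R := distr_fun (Num.sqrt s) / 2.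

Let rad_ge0 s : 0 <= rad s.
Proof. by rewrite divr_ge0// distr_fun_ge0. Qed.

Let rad_le s : rad s <= pi.
Proof.
rewrite ler_pdivrMr// mulrC; apply: distr_fun_le2pi; exact: sqrtr_ge0.
Qed.

Let lt_bP s x : 0 <= s -> (s < b x) <-> (x != 0 /\ `|x| < rad s).
Proof.
move=> s0; have [D0x|D0x] := pselect (D0 x); last first.
  rewrite b_out// ltNge s0; split=> // -[x0 xr]; case: D0x; split; last exact/eqP.
  rewrite /freq_itv /= in_itv /= -ltr_norml; exact: lt_le_trans xr (rad_le s).
have [Dx /eqP x0] := D0x; rewrite bE//.
have -> : (s < rearr_real x ^+ 2) = (Num.sqrt s < rearr_real x).
  by rewrite -{1}(sqr_sqrtr s0) ltr_pXn2r// nnegrE ?sqrtr_ge0 ?rearr_real_ge0.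
by split=> [/(rearr_realP x0 (sqrtr_ge0 s)) //|[_ /(rearr_realP x0 (sqrtr_ge0 s))]].
Qed.

Let lt_aE s : 0 <= s -> [set x | s < a x] = superlevel f (Num.sqrt s) `\` [set 0].
Proof.
move=> s0; rewrite superlevelE ?sqrtr_ge0// sqr_sqrtr//; apply/seteqP; split=> x /=.
  have [[Dx x0]|D0x] := pselect (D0 x); first by rewrite aE//; exact/eqP.
  by rewrite a_out// ltNge s0.
by move=> [[Dx sq] x0]; rewrite aE//; exact/eqP.
Qed.

Let lt_bE s : 0 <= s -> [set x | s < b x] = `](- rad s), (rad s)[%classic `\` [set 0].
Proof.
move=> s0; apply/seteqP; split=> x /=.
  by move=> /(lt_bP _ s0)[/eqP x0 xr]; split=> //; rewrite in_itv /= -ltr_norml.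
by rewrite in_itv /= -ltr_norml => -[xr /eqP x0]; apply/(lt_bP _ s0).
Qed.

Let mu_setD0 (E : set R) : measurable E -> mu (E `\` [set 0]) = mu E.
Proof.
move=> mE; have E0 : mu (E `&` [set 0]) = 0%E.
  apply/eqP; rewrite eq_le measure_ge0 andbT -(lebesgue_measure_set1 0).
  by apply: le_measure; rewrite ?inE//; exact: measurableI.
have -> : mu E = (mu (E `\` [set 0%R]) + mu (E `&` [set 0%R]))%E by exact: measureDI.
by rewrite E0 adde0.
Qed.

Let mu_abE s : 0 <= s -> mu [set x | s < a x] = mu [set x | s < b x].
Proof.
move=> s0; rewrite lt_aE// lt_bE// !mu_setD0//; last first.
  by apply: measurable_superlevel_freq; exact: sqrtr_ge0.
rewrite distr_funE ?sqrtr_ge0// lebesgue_measure_itv/= lte_fin.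
have [_|] := ltP; first by rewrite -EFinD opprK /rad -splitr.
rewrite lerNr => r0; congr _%:E; have := rad_ge0 s; have := distr_fun_ge0 (Num.sqrt s).
by move: r0; rewrite /rad; lra.
Qed.

Let b_rad s x : 0 <= s -> s < b x -> `|x| < rad s.
Proof. by move=> s0 /(lt_bP _ s0)[]. Qed.

Let a_rad s x : 0 <= s -> s < a x -> ~ (s < b x) -> rad s <= `|x|.
Proof.
move=> s0 sa /(lt_bP _ s0) nb; rewrite leNgt; apply/negP => xr; apply: nb; split=> //.
apply/eqP => x0; move: sa; rewrite a_out; first by rewrite ltNge s0.
by move=> [_]; apply.
Qed.

Let aD x : ~ D x -> a x = 0. Proof. by move=> Dx; apply: a_out => -[]. Qed.
Let bD x : ~ D x -> b x = 0. Proof. by move=> Dx; apply: b_out => -[]. Qed.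

Let integral_restr m (c : R -> R) : measurable_fun D c -> (forall x, 0 <= c x) ->
  (\int[mu]_x (weight m x * (c \_ D0) x)%:E = \int[mu]_(x in D) (weight m x * c x)%:E)%E.
Proof.
move=> mc c0.
have mwc : measurable_fun D (fun x => weight m x * c x).
  by apply: measurable_funM => //; apply: measurable_funTS; exact: measurable_weight.
rewrite (integral_setD_null (measurable_set1 0) (lebesgue_measure_set1 0) mwc); last first.
  by move=> x; rewrite mulr_ge0// weight_ge0.
rewrite [RHS]integral_mkcond; apply: eq_mu => x _; rewrite !patchE.
by case: ifP => // _; rewrite mulr0.
Qed.

Let L1_weight m h : L1 h -> L1 (fun x => weight m x * h x).
Proof.
move=> jh; apply: (L1_mulb (C := 4 ^+ m) jh).
  by apply: measurable_funTS; exact: measurable_weight.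
by move=> x _; rewrite ger0_norm ?weight_ge0 ?weight_le.
Qed.

Let jq : L1 q. Proof. by case: Lf. Qed.

Let mg2 : measurable_fun D (fun x => rearr_real x ^+ 2).
Proof. by apply: measurable_funTS; apply: measurable_funX; exact: measurable_rearr_real. Qed.

Let EFin_I h : L1 h -> (\int[mu]_(x in D) (h x)%:E = (I h)%:E)%E.
Proof. by move=> jh; rewrite fineK//; apply: integrable_fin_num. Qed.

Let int_a m : (\int[mu]_x (weight m x * a x)%:E = (I (fun x => weight m x * q x))%:E)%E.
Proof.
rewrite integral_restr// => [|x]; last exact: rdot_ge0.
exact: EFin_I (L1_weight m jq).
Qed.

Let L1_g2 : L1 (fun x => rearr_real x ^+ 2).
Proof.
apply/integrableP; split; first exact/measurable_EFinP.
rewrite (eq_mu (G := fun x => (weight 0 x * rearr_real x ^+ 2)%:E)); last first.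
  by move=> x _; rewrite /= ger0_norm ?sqr_ge0// /weight expr0 mul1r.
rewrite -integral_restr//; last by move=> x; exact: sqr_ge0.
apply: (le_lt_trans (comparison_le 0 ma mb a0 b0 aD bD mu_abE rad_ge0 rad_le b_rad a_rad)).
by rewrite int_a ltry.
Qed.

Let int_b m : (\int[mu]_x (weight m x * b x)%:E =
  (I (fun x => weight m x * rearr_real x ^+ 2))%:E)%E.
Proof.
rewrite integral_restr// => [|x]; last exact: sqr_ge0.
exact: EFin_I (L1_weight m L1_g2).
Qed.

Lemma L2_rearr_real : L2 (fun x => (rearr_real x)%:C).
Proof.
split; first by apply: cmeas_real; apply: measurable_funTS; exact: measurable_rearr_real.
by apply: L1_ext L1_g2 => x _; rewrite /rdot /= mulr0 addr0 expr2.
Qed.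

(** The superlevel sets are compared with the origin removed, because the
    real-valued version may differ from the rearrangement there. *)
Lemma rearr_weight_le m :
  I (fun x => weight m x * rearr_real x ^+ 2) <= I (fun x => weight m x * rdot (f x) (f x)).
Proof.
rewrite -lee_fin -int_a -int_b.
exact: (comparison_le m ma mb a0 b0 aD bD mu_abE rad_ge0 rad_le b_rad a_rad).
Qed.

Lemma rearr_weight_eq m : (0 < m)%N ->
  I (fun x => weight m x * rdot (f x) (f x)) = I (fun x => weight m x * rearr_real x ^+ 2) ->
  {ae mu, forall x, D x -> (Normc.normc (f x))%:E = rearr f x}.
Proof.
move=> m0 e.
have ae_ab : {ae mu, forall x, a x = b x}.
  apply: (comparison_eq ma mb a0 b0 aD bD mu_abE rad_ge0 rad_le b_rad a_rad m0).
    by rewrite int_a ltry.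
  by rewrite int_a int_b e.
have n0 : mu.-negligible [set (0 : R)].
  by apply/negligibleP => //; exact: lebesgue_measure_set1.
apply: negligibleS (negligibleU ae_ab n0) => x /= nx.
have [->|x0] := eqVneq x 0; first by right.
left => ab; apply: nx => Dx; rewrite rearr_fine//; congr _%:E.
apply/eqP; rewrite -(@eqrXn2 _ 2)// ?normc_ge0 ?rearr_real_ge0//.
by rewrite normc_sqE -/(q x) -aE// -bE// ab.
Qed.

Lemma rearr_ae_weight m :
  {ae mu, forall x, D x -> (Normc.normc (f x))%:E = rearr f x} ->
  I (fun x => weight m x * rdot (f x) (f x)) = I (fun x => weight m x * rearr_real x ^+ 2).
Proof.
move=> h; have jg2 := L1_g2; congr fine; apply: ae_eq_integral => //.
- by apply/measurable_EFinP; apply: L1_measurable; exact: L1_weight.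
- by apply/measurable_EFinP; apply: L1_measurable; exact: L1_weight.
- apply: (ae_imp h) => x hx Dx.
  by rewrite /rearr_real -(hx Dx) /= normc_sqE.
Qed.

End Rearrangement.

(** * The Fourier rearrangement *)

Section FourierRearr.
Context {R : realType} (u : int -> R[i]) (hu : l2Z u).
Notation mu := (@lebesgue_measure R).
Notation D := (@freq_itv R).
Notation I h := (\int[mu]_(x in D) h x).

Lemma fourierP : is_fourier u (fourier u).
Proof.
rewrite /fourier; case: xgetP => [f -> //|nf].
by have [f /nf] := riesz_fischer (l2Z_cvg hu).
Qed.

Lemma L2_fourier : L2 (fourier u).
Proof. by have /is_fourierP[] := fourierP. Qed.

(** Completeness of the exponentials enters here: the sequence is defined by an
    inverse transform, and its transform is the rearrangement again. *)
Lemma fourier_rearrP :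
  is_fourier (fourier_rearr u) (fun x => (rearr_real (fourier u) x)%:C%C).
Proof.
apply: is_fourier_inv_lsc.
- exact: L2_rearr_real L2_fourier.
- by move=> x; apply: rearr_real_ge0; exact: L2_fourier.
- move=> y t _ t0 ty; have [d d0 h] := rearr_real_lsc L2_fourier t0 ty.
  by exists d => // x _; exact: h.
Qed.

Lemma I_weight_rearr_real m :
  I (fun x => lapsym x ^+ m * rdot (rearr_real (fourier u) x)%:C%C (rearr_real (fourier u) x)%:C%C) =
  I (fun x => weight m x * rearr_real (fourier u) x ^+ 2).
Proof. by apply: eq_I => x _; rewrite /rdot /= mulr0 addr0 expr2. Qed.

End FourierRearr.

Theorem theorem3p2 (R : realType) (u : int -> R[i]) (k : nat) (hu : l2Z u) :
  let v := fourier_rearr u in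
  let symdec := {ae lebesgue_measure, forall x : R,
    freq_itv x -> (Normc.normc (fourier u x))%:E = rearr (fourier u) x} in
  [/\ (sqsum (iter k Lap v) <= sqsum (iter k Lap u))%E,
      (sqsum (Dop (iter k Lap v)) <= sqsum (Dop (iter k Lap u)))%E,
      (0 < k)%N ->
        (sqsum (iter k Lap u) = sqsum (iter k Lap v) <-> symdec) &
      (sqsum (Dop (iter k Lap u)) = sqsum (Dop (iter k Lap v)) <-> symdec)].
Proof.
move=> v symdec.
have Lf := L2_fourier hu.
rewrite (sqsum_iterLap _ (fourierP hu)) (sqsum_Dop_iterLap _ (fourierP hu)).
rewrite (sqsum_iterLap _ (fourier_rearrP hu)) (sqsum_Dop_iterLap _ (fourier_rearrP hu)).
rewrite !I_weight_rearr_real.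
split; rewrite ?lee_fin.
- exact: rearr_weight_le.
- exact: rearr_weight_le.
- move=> k0; split=> [[e]|h]; last by congr _%:E; exact: rearr_ae_weight.
  by apply: (rearr_weight_eq Lf _ e); rewrite muln_gt0.
- split=> [[e]|h]; last by congr _%:E; exact: rearr_ae_weight.
  by apply: (rearr_weight_eq Lf _ e).
Qed.
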